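(* Let $p,q,r\in\mathbb{N}_0$. There exist $n_0\in\mathbb{N}$, $\varepsilon>0$ and $C>0$, depending only on $p,q,r$, such that the following holds. Let $n\ge n_0$ and let $x_1<x_2<\ldots<x_n$ be real numbers with $\sum_{k=1}^n x_k=0$, $\sum_{k=1}^n x_k^2=1$ and $\sum_{k=1}^n|x_k|^3\le\varepsilon$. Then for every $t\in\mathbb{R}$, \[ \left|t^p\,\partial_t^q\left(\frac{1}{\sqrt{2\pi}}\mathrm{He}_r(t)e^{-t^2/2}-\sum_{k=1}^n\frac{\left(x_k-\frac{t}{n}\right)_+^{n-2-r}}{\prod_{j\ne k}(x_k-x_j)}\right)\right|\le C\sum_{k=1}^n|x_k|^3 . \]
   Context: $\mathbb{N}_0=\{0,1,2,\ldots\}$. For real $y$ and an integer $d\ge 1$, $(y)_+^{d}=\max(y,0)^{d}$. The product $\prod_{j\neq k}$ runs over $j\in\{1,\ldots,n\}\setminus\{k\}$. $\mathrm{He}_r$ is the $r$-th probabilists' Hermite polynomial, defined by $\mathrm{He}_r(z)e^{-z^2/2}=(-1)^r\left(\frac{d}{dz}\right)^r e^{-z^2/2}$. *)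

(* Defs.v *)
From HB Require Import structures.
From mathcomp Require Import all_boot all_order all_algebra.
From mathcomp Require Import all_classical all_reals all_analysis.

Set Implicit Arguments.
Unset Strict Implicit.
Unset Printing Implicit Defensive.

Import Order.TTheory GRing.Theory Num.Theory.
Import numFieldNormedType.Exports.

Local Open Scope ring_scope.

(* The value at z of the r-th probabilists' Hermite polynomial, obtained by
   solving He_r(z) e^{-z^2/2} = (-1)^r (d/dz)^r e^{-z^2/2} for He_r(z). *)
Definition hermite (R : realType) (r : nat) (z : R) : R :=
  (-1) ^+ r * derive1n r (fun y : R => expR (- y ^+ 2 / 2)) z
  / expR (- z ^+ 2 / 2).

Lemma hermiteE (R : realType) (r : nat) (z : R) :
  hermite r z * expR (- z ^+ 2 / 2) =
  (-1) ^+ r * derive1n r (fun y : R => expR (- y ^+ 2 / 2)) z.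
Proof. by rewrite /hermite divfK// gt_eqF// expR_gt0. Qed.

(* Main.v *)
(** With S_r(t) the sum over the knots and s = t/n, partial fractions give, for
    every real a with a (x_k - s) < 1 for all k,
      S_r(t) = (1/2pi) int z^r / prod_k (1 - z (x_k - s)) dxi,   z = a + i xi,
    while He_r(t) phi(t) = (1/2pi) int z^r exp(-z t + z^2/2) dxi.  Each derivative
    in t raises r by one, up to the sign and a factor 1 + O(1/n) for S_r, so q = 0
    suffices; note 1/n <= 8 L^2 with L = sum |x_k|^3.
    Put X = max |x_k|, so X^3 <= L.  If |t| X <= 1/20, take a = t (the saddle
    point): both integrands are products over k, their factors differ by third
    order terms, and a telescoping estimate bounds the difference by L times an
    integrable function of xi with Gaussian decay in t.  If |t| X > 1/20, both
    functions are separately O(|t|^-(p+3)) = O(|t|^-p L): for S_r use a = sgn t,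
    where prod_k |1 - z (x_k - s)| dominates (1 + |t|/n)^n.
    Integrals over xi are only used through primitives on [0, +oo[ and their
    limits; real parts of the integrands are even in xi. *)
Require Import Defs.
From HB Require Import structures.
From mathcomp Require Import all_boot all_order all_algebra.
From mathcomp Require Import all_classical all_reals all_analysis.
From mathcomp Require Import complex ring lra zify.

Set Implicit Arguments.
Unset Strict Implicit.
Unset Printing Implicit Defensive.

Import Order.TTheory GRing.Theory Num.Theory.
Import numFieldNormedType.Exports.
Import ComplexField.Normc.

Local Open Scope ring_scope.

Local Notation Re := complex.Re.
Local Notation Im := complex.Im.

(** * Derivatives and the complex exponential *)

(** The telescoped comparison needs bounds factor by factor, while a single [1 - z * (x_k - s)] may
    have modulus below 1. Multiplying the k-th factor by [expR (a * x_k)] costs nothing, the x_k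
    having sum 0, and cancels its first-order term; a loss of order [(a * x_k)^2] and a gain of
    order [a * s] remain. For a = t they total about -t^2/2 and t^2 in the exponent. The estimates
    weaken this to -17/20 t^2 and 9/10 t^2, which still leaves the decay [expR (t^2 / 20)]; |t| X <=
    1/20 is what makes such crude constants valid. In xi a power of [1 + c * xi^2] replaces Gaussian
    decay: it comes from spreading the total [sum x_k^2 = 1] over small knots, and is as high as
    wanted once X is small. No contour is shifted: on every admissible line the primitive is a sum
    of arctangents whose limit depends only on the signs of the [x_k - s]. In the tail, 1 < 20 |t| X
    gives 1 <= (20 |t| X)^3, so X^3 <= L yields the factor L at the price of three more powers of
    |t|. *)

Section Derivation.
Variable R : realType.
Implicit Types (f g : R -> R) (x df dg c : R).

Lemma is_derive_id1 x : is_derive x 1 (fun y : R => y) 1.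
Proof. exact: is_derive_id. Qed.

Lemma is_derive_cst1 c x : is_derive x 1 (fun _ : R => c) 0.
Proof. exact: is_derive_cst. Qed.

Lemma is_derive_D1 f g x df dg : is_derive x 1 f df -> is_derive x 1 g dg ->
  is_derive x 1 (fun y => f y + g y) (df + dg).
Proof. by move=> hf hg; exact: (is_deriveD hf hg). Qed.

Lemma is_derive_N1 f x df : is_derive x 1 f df ->
  is_derive x 1 (fun y => - f y) (- df).
Proof. by move=> hf; exact: (is_deriveN hf). Qed.

Lemma is_derive_M1 f g x df dg : is_derive x 1 f df -> is_derive x 1 g dg ->
  is_derive x 1 (fun y => f y * g y) (f x * dg + g x * df).
Proof. by move=> hf hg; exact: (is_deriveM hf hg). Qed.

Lemma is_derive_X1 f n x df : is_derive x 1 f df ->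
  is_derive x 1 (fun y => f y ^+ n) (n%:R * f x ^+ n.-1 * df).
Proof.
move=> hf; have := is_deriveX n hf.
by rewrite (_ : f ^+ n = (fun y => f y ^+ n))//; apply/funext => y; rewrite exprfctE.
Qed.

Lemma is_derive_comp1 f g x df dg : is_derive (g x) 1 f df ->
  is_derive x 1 g dg -> is_derive x 1 (fun y => f (g y)) (df * dg).
Proof. by move=> hf hg; exact: (is_derive1_comp hf hg). Qed.

Lemma is_derive_exp1 f x df : is_derive x 1 f df ->
  is_derive x 1 (fun y => expR (f y)) (expR (f x) * df).
Proof. by move=> hf; exact: (is_derive_comp1 (is_derive_expR _) hf). Qed.

Lemma is_derive_sum1 (I : Type) (r : seq I) (F : I -> R -> R) (dF : I -> R) x :
  (forall i, is_derive x 1 (F i) (dF i)) ->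
  is_derive x 1 (fun y => \sum_(i <- r) F i y) (\sum_(i <- r) dF i).
Proof.
move=> h; elim: r => [|i r ih].
  rewrite big_nil (_ : (fun y => _) = fun=> 0); first exact: is_derive_cst1.
  by apply/funext => y; rewrite big_nil.
rewrite big_cons (_ : (fun y => _) = fun y => F i y + \sum_(j <- r) F j y).
  exact: is_derive_D1.
by apply/funext => y; rewrite big_cons.
Qed.

Lemma is_derive_continuous f x df : is_derive x 1 f df -> {for x, continuous f}.
Proof. by move=> h; apply: differentiable_continuous; apply/derivable1_diffP. Qed.

End Derivation.

Section ComplexModulus.
Variable R : realType.
Local Open Scope complex_scope.
Implicit Types z w : R[i].

Lemma normcD z w : normc (z + w) <= normc z + normc w.
Proof. exact: (@le_normcD R z w). Qed.

Lemma normc_ge0 z : 0 <= normc z.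
Proof. by case: z => a b; rewrite /normc sqrtr_ge0. Qed.

Lemma normc_gt0 z : z != 0 -> 0 < normc z.
Proof.
move=> z0; rewrite lt_neqAle normc_ge0 andbT eq_sym.
by apply: contra z0 => /eqP/eq0_normc ->.
Qed.

Lemma normcN z : normc (- z) = normc z.
Proof. by case: z => a b; rewrite /normc /= !sqrrN. Qed.

Lemma normcB z w : normc (z - w) <= normc z + normc w.
Proof. by rewrite -[in leRHS](normcN w) normcD. Qed.

Lemma normcX z n : normc (z ^+ n) = normc z ^+ n.
Proof. by elim: n => [|n ih]; rewrite ?expr0 ?normc1// !exprS normcM ih. Qed.

Lemma normc_real (a : R) : normc a%:C = `|a|.
Proof. by rewrite /normc /= expr0n/= addr0 sqrtr_sqr. Qed.

Lemma normc_prod (I : Type) (r : seq I) (F : I -> R[i]) :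
  normc (\prod_(i <- r) F i) = \prod_(i <- r) normc (F i).
Proof. exact: (big_morph _ (@normcM R) (@normc1 R)). Qed.

Lemma sqr_normc z : normc z ^+ 2 = Re z ^+ 2 + Im z ^+ 2.
Proof. by case: z => a b; rewrite /normc /= sqr_sqrtr// addr_ge0// sqr_ge0. Qed.

Lemma Re_le_normc z : `|Re z| <= normc z.
Proof.
case: z => a b; rewrite /normc /= -sqrtr_sqr ler_wsqrtr//.
by rewrite lerDl sqr_ge0.
Qed.

Lemma normc_le_ReIm z : normc z <= `|Re z| + `|Im z|.
Proof.
rewrite -(@ler_pXn2r _ 2)// ?nnegrE ?normc_ge0 ?addr_ge0//.
rewrite sqr_normc sqrrD !real_normK ?num_real// addrAC lerDl mulrn_wge0// mulr_ge0.
Qed.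

Lemma Im_le_normc z : `|Im z| <= normc z.
Proof.
case: z => a b; rewrite /normc /= -sqrtr_sqr ler_wsqrtr//.
by rewrite lerDr sqr_ge0.
Qed.

Lemma ReD z w : Re (z + w) = Re z + Re w.
Proof. by case: z; case: w. Qed.

Lemma ReN z : Re (- z) = - Re z.
Proof. by case: z. Qed.

Lemma ReM_real (a : R) z : Re (a%:C * z) = a * Re z.
Proof. by case: z => b c /=; rewrite mul0r subr0. Qed.

Lemma Re_sum (I : Type) (r : seq I) (F : I -> R[i]) :
  Re (\sum_(i <- r) F i) = \sum_(i <- r) Re (F i).
Proof. exact: (big_morph _ ReD). Qed.

Definition cexp w : R[i] := (expR (Re w) * cos (Im w)) +i* (expR (Re w) * sin (Im w)).

Lemma cexp_real (a : R) : cexp a%:C = (expR a)%:C.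
Proof. by rewrite /cexp /= cos0 sin0 mulr1 mulr0. Qed.

Lemma cexpD z w : cexp (z + w) = cexp z * cexp w.
Proof.
case: z => a b; case: w => c d; rewrite /cexp /= expRD cosD sinD.
by apply/eqP; rewrite eq_complex /=; apply/andP; split; apply/eqP; ring.
Qed.

Lemma cexp_sum (I : Type) (r : seq I) (F : I -> R[i]) :
  cexp (\sum_(i <- r) F i) = \prod_(i <- r) cexp (F i).
Proof. by apply: (big_morph _ cexpD); rewrite cexp_real expR0. Qed.

Lemma normc_cexp w : normc (cexp w) = expR (Re w).
Proof.
rewrite /normc /cexp /= !exprMn -mulrDr cos2Dsin2 mulr1 sqrtr_sqr.
by rewrite ger0_norm ?expR_ge0.
Qed.

(** A complex function need not have a mean value point, so real and imaginary parts are treated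
    separately and their bounds added; hence the factor 2. *)
Lemma complex_mean_value (g dg : R -> R[i]) (K : R) :
  (forall l : R, is_derive l 1 (fun u : R => Re (g u)) (Re (dg l))) ->
  (forall l : R, is_derive l 1 (fun u : R => Im (g u)) (Im (dg l))) ->
  (forall l : R, 0 <= l <= 1 -> normc (dg l) <= K) ->
  normc (g 1 - g 0) <= 2 * K.
Proof.
move=> hr hi hK.
have mv (f df : R -> R) : (forall l : R, is_derive l 1 f (df l)) ->
    (forall l : R, 0 <= l <= 1 -> `|df l| <= K) -> `|f 1 - f 0| <= K.
  move=> hf hdf.
  have [|c c01 ->] := @MVT_segment _ f df 0 1 ler01 (fun x _ => hf x).
    by apply: continuous_subspaceT => x; apply: is_derive_continuous (hf x).
  by rewrite subr0 mulr1; apply: hdf; move: c01; rewrite in_itv.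
apply: (le_trans (normc_le_ReIm _)); rewrite mulr_natl mulr2n lerD//.
- have := mv _ _ hr; rewrite ReD ReN; apply => l /hK.
  exact: le_trans (Re_le_normc _).
- have := mv _ _ hi; rewrite (_ : Im (g 1 - g 0) = Im (g 1) - Im (g 0)); last first.
    by case: (g 1) (g 0) => ? ? [].
  by apply => l /hK; exact: le_trans (Im_le_normc _).
Qed.

Lemma normcZ (l : R) w : 0 <= l <= 1 -> normc (l%:C * w) <= normc w.
Proof.
case/andP=> l0 l1; rewrite normcM normc_real ger0_norm//.
by rewrite ler_piMl// normc_ge0.
Qed.

Lemma expR1_le4 : expR 1 <= 4 :> R.
Proof.
have h : 1 / 2 <= expR (- (1 / 2)) :> R by have := expR_ge1Dx (- (1 / 2) : R); lra.
have -> : 1 = 1 / 2 + 1 / 2 :> R by lra.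
rewrite expRD; move: h; rewrite expRN; have := expR_gt0 (1 / 2 : R).
set e := expR _ => e0 h.
have : e <= 2 by rewrite -(ler_pM2r (_ : 0 < e^-1)) ?invr_gt0// divff ?gt_eqF//; lra.
by nra.
Qed.

(** Start of an iteration along the ray [l%:C * w]: the derivative in l of each Taylor remainder is
    w times the previous one, and each order costs a factor 2 from the mean value bound. With
    [expR 1 <= 4] this gives the constants 8, 16, 32. *)
Lemma cexp_taylor1 w : normc w <= 1 -> normc (cexp w - 1) <= 8 * normc w.
Proof.
move=> w1.
have := @complex_mean_value (fun l => cexp (l%:C * w)) (fun l => w * cexp (l%:C * w))
  (4 * normc w).
rewrite mul0r cexp_real expR0 mul1r !(mulrA 2) -!natrM; apply.
- case: w {w1} => c d l /=; apply: is_derive_eq.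
  by rewrite /GRing.scale/=; ring.
- case: w {w1} => c d l /=; apply: is_derive_eq.
  by rewrite /GRing.scale/=; ring.
- move=> l l01; rewrite normcM mulrC ler_wpM2r ?normc_ge0// normc_cexp.
  apply: (@le_trans _ _ (expR 1)); last exact: expR1_le4.
  rewrite ler_expR; apply: le_trans w1; apply: le_trans (normcZ _ l01).
  exact: le_trans (ler_norm _) (Re_le_normc _).
Qed.

Lemma cexp_taylor2 w : normc w <= 1 -> normc (cexp w - 1 - w) <= 16 * normc w ^+ 2.
Proof.
move=> w1.
have := @complex_mean_value (fun l => cexp (l%:C * w) - l%:C * w)
  (fun l => w * (cexp (l%:C * w) - 1)) (8 * normc w ^+ 2).
rewrite mul0r subr0 cexp_real expR0 mul1r !(mulrA 2) -!natrM addrAC; apply.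
- case: w {w1} => c d l /=; apply: is_derive_eq.
  by rewrite /GRing.scale/=; ring.
- case: w {w1} => c d l /=; apply: is_derive_eq.
  by rewrite /GRing.scale/=; ring.
- move=> l l01; rewrite normcM mulrC expr2 mulrA ler_wpM2r ?normc_ge0//.
  have lw := normcZ w l01.
  apply: le_trans (cexp_taylor1 (le_trans lw w1)) _.
  by rewrite ler_wpM2l.
Qed.

Lemma cexp_taylor3 w : normc w <= 1 ->
  normc (cexp w - 1 - w - w ^+ 2 / 2) <= 32 * normc w ^+ 3.
Proof.
move=> w1.
have := @complex_mean_value
  (fun l => cexp (l%:C * w) - l%:C * w - (l ^+ 2 / 2)%:C * w ^+ 2)
  (fun l => w * (cexp (l%:C * w) - 1 - l%:C * w)) (16 * normc w ^+ 3).
rewrite expr0n/= !mul0r !subr0 cexp_real expR0 mul1r !(mulrA 2) -!natrM expr1n mul1r.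
rewrite (_ : cexp w - w - (2^-1)%:C * w ^+ 2 - 1%:C =
  cexp w - 1 - w - w ^+ 2 / 2); last first.
  have -> : (2^-1)%:C = 2^-1 :> R[i] by rewrite fmorphV rmorph_nat.
  by rewrite rmorph1; field.
apply.
- case: w {w1} => c d l /=; apply: is_derive_eq.
  by rewrite /GRing.scale/=; field.
- case: w {w1} => c d l /=; apply: is_derive_eq.
  by rewrite /GRing.scale/=; field.
- move=> l l01; rewrite normcM mulrC exprSr mulrA ler_wpM2r ?normc_ge0//.
  have lw := normcZ w l01.
  apply: le_trans (cexp_taylor2 (le_trans lw w1)) _.
  by rewrite ler_wpM2l// ler_pXn2r// nnegrE normc_ge0.
Qed.

End ComplexModulus.

(** * Bounds for the factors of the kernels *)

Section RealBounds.
Variable R : realType.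
Local Open Scope complex_scope.

(** The tangent to the exponential at [th * L] lies below it at L and at 0; in the sum with weights
    th and 1 - th the first-order terms cancel. *)
Lemma expR_le_chord (th L : R) : 0 <= th <= 1 ->
  expR (th * L) <= 1 + th * (expR L - 1).
Proof.
case/andP=> th0 th1; have p0 := expR_gt0 (th * L).
have h1 : expR (th * L) * (1 + (1 - th) * L) <= expR L.
  have -> : expR L = expR (th * L) * expR ((1 - th) * L) by rewrite -expRD; congr expR; ring.
  by rewrite ler_pM2l// expR_ge1Dx.
have h2 : expR (th * L) * (1 - th * L) <= 1.
  have e1 : expR (th * L) * expR (- (th * L)) = 1 by rewrite -expRD subrr expR0.
  by rewrite -[leRHS]e1 ler_pM2l// expR_ge1Dx.
have th1' : 0 <= 1 - th by rewrite subr_ge0.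
have := lerD (ler_wpM2l th0 h1) (ler_wpM2l th1' h2).
by set e := expR _ => h; lra.
Qed.

Lemma expR_sum (I : Type) (r : seq I) (F : I -> R) :
  expR (\sum_(i <- r) F i) = \prod_(i <- r) expR (F i).
Proof. exact: (big_morph _ (@expRD R) (@expR0 R)). Qed.

(* Bernoulli with exponent [k i / M] in [0, 1]: [(1 + M) `^ (k i / M) <= 1 + k i]. *)
Lemma prod_ge_pow (I : Type) (r : seq I) (k : I -> R) (M : R) (m : nat) :
  0 < M -> (forall i, 0 <= k i <= M) -> m%:R * M <= \sum_(i <- r) k i ->
  (1 + M) ^+ m <= \prod_(i <- r) (1 + k i).
Proof.
move=> M0 hk hs; have M1 : 0 < 1 + M by rewrite addr_gt0.
have e1 : expR (ln (1 + M)) = 1 + M by rewrite lnK.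
apply: (@le_trans _ _ (\prod_(i <- r) expR (k i / M * ln (1 + M)))).
  rewrite -expR_sum -big_distrl -big_distrl/=.
  rewrite -[in leLHS]e1 -expRM_natl ler_expR ler_wpM2r//.
    by rewrite ln_ge0// lerDl ltW.
  by rewrite ler_pdivlMr.
apply: ler_prod => i _; rewrite expR_ge0/=.
have /andP[k0 kM] := hk i.
have h01 : 0 <= k i / M <= 1.
  by rewrite divr_ge0 ?(ltW M0)//= ler_pdivrMr// mul1r.
apply: le_trans (expR_le_chord _ h01) _.
by rewrite e1 addrAC subrr add0r divfK// gt_eqF.
Qed.

Lemma expR_ge_pow (y : R) (Q : nat) : 0 <= y -> (1 + y / Q.+1%:R) ^+ Q.+1 <= expR y.
Proof.
move=> y0; have -> : expR y = expR (y / Q.+1%:R) ^+ Q.+1.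
  by rewrite -expRM_natl mulrC divfK// pnatr_eq0.
by rewrite ler_pXn2r ?nnegrE ?expR_ge0 ?expR_ge1Dx// addr_ge0// divr_ge0.
Qed.

Lemma pow_le_gauss (Q : nat) (c : R) : 0 < c ->
  exists2 K : R, 0 < K & forall t : R, (1 + `|t|) ^+ Q <= K * expR (c * t ^+ 2).
Proof.
move=> c0.
(* Chosen so that [(1 + |t|)^2 <= A * (1 + c * t^2 / Q.+1)]; the power Q.+1 of the last bracket is
   at most [expR (c * t^2)]. *)
pose A := 2 * (1 + Q.+1%:R / c).
have A1 : 2 <= A by rewrite /A ler_peMr// lerDl divr_ge0// ltW.
exists (A ^+ Q.+1); first by rewrite exprn_gt0// (lt_le_trans _ A1).
move=> t; have t0 := normr_ge0 t.
apply: (@le_trans _ _ ((1 + `|t|) ^+ (2 * Q.+1))).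
  rewrite ler_weXn2l ?lerDl//.
  by rewrite (leq_trans (leqnSn Q))// leq_pmull.
have ct : 0 <= c * t ^+ 2 by rewrite mulr_ge0 ?(ltW c0)// sqr_ge0.
apply: (@le_trans _ _ (A ^+ Q.+1 * (1 + c * t ^+ 2 / Q.+1%:R) ^+ Q.+1)); last first.
  by rewrite ler_pM2l ?expR_ge_pow// exprn_gt0// (lt_le_trans _ A1).
rewrite exprM -exprMn ler_pXn2r ?nnegrE ?sqr_ge0//; last first.
  by rewrite mulr_ge0 ?(le_trans _ A1)// addr_ge0// divr_ge0.
have -> : A * (1 + c * t ^+ 2 / Q.+1%:R) =
    2 * (1 + t ^+ 2 + Q.+1%:R / c + c * t ^+ 2 / Q.+1%:R).
  have : 0 < Q.+1%:R :> R by [].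
  by rewrite /A; set q := Q.+1%:R => q0; field; rewrite !gt_eqF.
have h1 : 0 <= Q.+1%:R / c by rewrite divr_ge0// ltW.
have h2 : 0 <= c * t ^+ 2 / Q.+1%:R by rewrite divr_ge0.
have h3 := sqr_ge0 (1 - `|t|); have h4 : `|t| ^+ 2 = t ^+ 2 by rewrite real_normK ?num_real.
move: h1 h2 h3 h4; set H1 := _ / c; set H2 := _ / _; set T := `|t| => h1 h2 h3 h4.
by rewrite -h4; lra.
Qed.

Lemma expR_ge_sqr (u : R) : - 2 <= u -> (1 + u / 2) ^+ 2 <= expR u.
Proof.
move=> hu; have -> : expR u = expR (u / 2) ^+ 2.
  by rewrite expr2 -expRD; congr expR; lra.
by rewrite ler_pXn2r ?expR_ge1Dx// nnegrE ?expR_ge0//; lra.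
Qed.

(* The factor [expR (a * x)] is free in the product over the knots, whose sum
   is [0]; it removes the first-order term of [1 - a * x]. *)
Lemma spline_factor_ge (a x s xi : R) : `|a * x| <= 1/20 -> 0 <= a * s <= 1/20 ->
  ((1 - 4/5 * (a * x) ^+ 2) * (1 + 19/20 * (a * s))) ^+ 2
    * (1 + xi ^+ 2 * ((x - s) ^+ 2 / 8))
  <= (expR (a * x) * normc (1 - (a +i* xi) * (x - s)%:C)) ^+ 2.
Proof.
rewrite ler_norml => /andP[u1 u2] /andP[w0 w1].
rewrite [in leRHS]exprMn sqr_normc /= !mulr0 subr0 !add0r.
have -> : (1 - a * (x - s)) = 1 - a * x + a * s by ring.
rewrite sqrrN [(xi * _) ^+ 2]exprMn.
have yy : 0 <= xi ^+ 2 * (x - s) ^+ 2 by rewrite mulr_ge0 ?sqr_ge0.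
move: yy; set Y := xi ^+ 2 * (x - s) ^+ 2 => yy.
have -> : xi ^+ 2 * ((x - s) ^+ 2 / 8) = Y / 8 by rewrite mulrA.
move: u1 u2 w0 w1; set u := a * x; set w := a * s => u1 u2 w0 w1.
have E2 : (1 + u / 2) ^+ 2 <= expR u by apply: expR_ge_sqr; lra.
move: E2; set e := expR u => E2.
set Z := (1 - _) * _.
have Z0 : 0 <= Z by rewrite /Z mulr_ge0//; nra.
have Z2 : Z <= 2 by rewrite /Z; nra.
have e9 : 9/10 <= e by nra.
have eZ : Z <= e * (1 - u + w).
  apply: (@le_trans _ _ ((1 - 4/5 * u ^+ 2) + 19/20 * w)).
    by rewrite /Z mulrDr mulr1 lerD2l ler_piMl//; nra.
  (* [(1 + u/2)^2 * (1 - u)] equals [1 - 3/4 u^2 - u^3/4]; passing from 3/4 to 4/5 absorbs the cubic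
     term. *)
  have h1 : 1 - 4/5 * u ^+ 2 <= e * (1 - u).
    have : (1 + u / 2) ^+ 2 * (1 - u) <= e * (1 - u) by rewrite ler_wpM2r//; lra.
    by apply: le_trans; nra.
  have h2 : 19/20 * w <= e * w by rewrite ler_wpM2r//; nra.
  by rewrite mulrDr lerD.
rewrite mulrDr mulr1 mulrDr lerD//.
  by rewrite -exprMn ler_pXn2r// nnegrE// (le_trans Z0).
have : Z ^+ 2 / 8 <= e ^+ 2 by nra.
by move=> /(ler_wpM2r yy); lra.
Qed.

(** The right side is the squared inverse modulus of [cexp (z * (x - s) + z^2 * x^2 / 2)], z = a + i
    xi, after multiplication by [expR (a * x)]. The left side agrees with that of [spline_factor_ge]
    except for the coefficient of [xi^2], so that one weight can serve both kernels. *)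
Lemma gauss_factor_ge (a x s xi : R) : `|a * x| <= 1/20 -> 0 <= a * s <= 1/20 ->
  ((1 - 4/5 * (a * x) ^+ 2) * (1 + 19/20 * (a * s))) ^+ 2
    * (1 + xi ^+ 2 * x ^+ 2)
  <= expR (a * s - (a * x) ^+ 2 / 2 + xi ^+ 2 * x ^+ 2 / 2) ^+ 2.
Proof.
rewrite ler_norml => /andP[u1 u2] /andP[w0 w1].
have yy : 0 <= xi ^+ 2 * x ^+ 2 by rewrite mulr_ge0 ?sqr_ge0.
move: yy; set Y := xi ^+ 2 * x ^+ 2 => yy.
move: u1 u2 w0 w1; set u := a * x; set w := a * s => u1 u2 w0 w1.
have -> : expR (w - u ^+ 2 / 2 + Y / 2) ^+ 2 = (expR w ^+ 2 * expR (- u ^+ 2)) * expR Y.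
  by rewrite !expr2 -!expRD; congr expR; lra.
apply: ler_pM => //; rewrite ?sqr_ge0 ?addr_ge0 ?expR_ge1Dx//.
rewrite exprMn mulrC; apply: ler_pM; rewrite ?sqr_ge0//.
  rewrite ler_pXn2r// ?nnegrE ?expR_ge0//; last by lra.
  by apply: le_trans (expR_ge1Dx _); lra.
apply: le_trans (expR_ge1Dx _).
have : u ^+ 2 <= 1 / 2 by nra.
have := sqr_ge0 u; move: (u ^+ 2) => v; nra.
Qed.

End RealBounds.

Section Telescoping.
Variable R : realType.

(** In each telescoped term all factors but one are untouched, and together with their weights they
    have modulus at most 1. The product of the weights thus survives on the left, where it carries
    the decay of the kernels. *)
Lemma normc_prod_sub (I : Type) (r : seq I) (A B : I -> R[i]) (Q : I -> R) :
  (forall i, 0 < Q i) -> (forall i, Q i * normc (A i) <= 1) ->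
  (forall i, Q i * normc (B i) <= 1) ->
  (\prod_(i <- r) Q i) * normc (\prod_(i <- r) A i - \prod_(i <- r) B i)
  <= \sum_(i <- r) Q i * normc (A i - B i).
Proof.
move=> Q0 hA hB; elim: r => [|i r ih].
  by rewrite !big_nil subrr normc0 mulr0.
rewrite !big_cons.
set PA := \prod_(j <- r) A j in ih *; set PB := \prod_(j <- r) B j in ih *.
set PQ := \prod_(j <- r) Q j in ih *.
have PQ0 : 0 < PQ by apply: prodr_gt0.
have -> : A i * PA - B i * PB = (A i - B i) * PA + B i * (PA - PB) by ring.
apply: (@le_trans _ _ (Q i * PQ * (normc (A i - B i) * normc PA +
    normc (B i) * normc (PA - PB)))).
  by rewrite ler_pM2l ?mulr_gt0// -!normcM normcD.
have hPA : PQ * normc PA <= 1.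
  rewrite /PA normc_prod /PQ -big_split/=.
  apply: (@le_trans _ _ (\prod_(j <- r) 1)); last by rewrite big1_eq.
  by apply: ler_prod => j _; rewrite hA mulr_ge0 ?normc_ge0 ?ltW.
rewrite mulrDr lerD//.
  have -> : Q i * PQ * (normc (A i - B i) * normc PA) =
    (Q i * normc (A i - B i)) * (PQ * normc PA) by ring.
  by rewrite ler_piMr// mulr_ge0 ?normc_ge0 ?ltW.
apply: le_trans ih.
have -> : Q i * PQ * (normc (B i) * normc (PA - PB)) =
    (Q i * normc (B i)) * (PQ * normc (PA - PB)) by ring.
by rewrite ler_piMl// mulr_ge0 ?normc_ge0 ?ltW.
Qed.

End Telescoping.

(** * Partial fractions and inversion of the spline kernel *)

Section PartialFractions.
Variable F : fieldType.

Lemma size_prod_XsubC_neq (n : nat) (y : 'I_n -> F) (k : 'I_n) :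
  size (\prod_(j < n | j != k) ('X - (y j)%:P)) = n.
Proof.
have n0 : (0 < n)%N by case: n k {y} => // -[].
rewrite -big_filter size_prod_XsubC -[RHS](prednK n0) -[n in RHS]card_ord.
by rewrite -(cardC1 k) cardE.
Qed.

Lemma prod_subr_neq0 (n : nat) (y : 'I_n -> F) (k : 'I_n) : injective y ->
  \prod_(j < n | j != k) (y k - y j) != 0.
Proof.
move=> yI; apply/prodf_neq0 => j jk; rewrite subr_eq0.
by apply: contra jk => /eqP/yI ->.
Qed.

(** The difference of the two sides vanishes at n distinct points and has size at most n. *)
Lemma lagrange_interpolation (n : nat) (y : 'I_n -> F) (p : {poly F}) :
  injective y -> (size p <= n)%N ->
  p = \sum_(k < n) (p.[y k] / \prod_(j < n | j != k) (y k - y j))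
        *: \prod_(j < n | j != k) ('X - (y j)%:P).
Proof.
move=> yI sp; apply/eqP; rewrite -subr_eq0; apply/eqP.
apply: (@roots_geq_poly_eq0 _ _ [seq y i | i <- enum 'I_n]).
- apply/allP => _ /mapP[i _ ->]; rewrite /root hornerD hornerN horner_sum.
  rewrite (bigD1 i)//= [X in _ - (_ + X)]big1 ?addr0; last first.
    move=> k ki; rewrite hornerZ horner_prod.
    have -> : \prod_(j < n | j != k) ('X - (y j)%:P).[y i] = 0.
      by rewrite (bigD1 i) 1?eq_sym//= !hornerE subrr mul0r.
    by rewrite mulr0.
  rewrite hornerZ horner_prod.
  under [X in _ * X]eq_bigr do rewrite !hornerE.
  by rewrite divfK ?subrr// prod_subr_neq0.
- by rewrite map_inj_uniq ?enum_uniq.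
- rewrite size_map size_enum_ord (leq_trans (size_polyD _ _))// geq_max sp size_polyN.
  apply: (leq_trans (size_sum _ _ _)); apply/bigmax_leqP => k _.
  by rewrite (leq_trans (size_scale_leq _ _))// size_prod_XsubC_neq.
Qed.

(** Comparison of the coefficients of degree n - 1 in the Lagrange formula for ['X^m]: a divided
    difference of order n - 1 kills polynomials of lower degree. *)
Lemma sum_pow_div_prod_eq0 (n m : nat) (y : 'I_n -> F) :
  injective y -> (m.+1 < n)%N ->
  \sum_(k < n) y k ^+ m / \prod_(j < n | j != k) (y k - y j) = 0.
Proof.
move=> yI mn.
have sX : (size ('X^m : {poly F}) <= n)%N by rewrite size_polyXn ltnW.
have /(congr1 (fun q : {poly F} => q`_n.-1)) := lagrange_interpolation yI sX.
rewrite coefXn -[in X in X = _]subn1 coef_sum.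
have -> : (n - 1 == m)%N = false by lia.
rewrite mulr0n => E; rewrite [RHS]E; apply: eq_bigr => k _.
rewrite coefZ hornerXn -[LHS]mulr1; congr (_ * _).
have /monicP := @monic_prod_XsubC F 'I_n (index_enum _) (fun j => j != k) y.
by rewrite lead_coefE size_prod_XsubC_neq => ->.
Qed.

(** Lagrange's formula for ['X^(n - 1 - r)] evaluated at [z^-1], with the powers of z cleared. *)
Lemma partial_fraction_pow (n r : nat) (y : 'I_n -> F) (z : F) :
  injective y -> (r < n)%N -> z != 0 -> (forall k, 1 - z * y k != 0) ->
  z ^+ r / \prod_(k < n) (1 - z * y k) =
  \sum_(k < n) y k ^+ (n - 1 - r) / \prod_(j < n | j != k) (y k - y j)
     / (1 - z * y k).
Proof.
move=> yI rn z0 zy.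
have sX : (size ('X^(n - 1 - r) : {poly F}) <= n)%N.
  by rewrite size_polyXn; lia.
have /(congr1 (fun q : {poly F} => q.[z^-1])) := lagrange_interpolation yI sX.
rewrite hornerXn horner_sum => E.
have P0 : \prod_(k < n) (1 - z * y k) != 0 by apply/prodf_neq0.
have wy j : z^-1 - y j = (1 - z * y j) / z by rewrite mulrBl mul1r mulrAC divff// mul1r.
have zn : z ^+ n = z * z ^+ (n - 1 - r) * z ^+ r.
  by rewrite -exprS -exprD; congr (_ ^+ _); lia.
apply: (mulfI z0).
transitivity (z ^+ n * (z^-1) ^+ (n - 1 - r) / \prod_(k < n) (1 - z * y k)).
  rewrite zn exprVn; have := expf_neq0 (n - 1 - r) z0; move: (z ^+ _) => u u0.
  by field; rewrite P0 u0.
rewrite E mulr_sumr mulr_suml mulr_sumr; apply: eq_bigr => k _.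
rewrite hornerZ hornerXn horner_prod.
have -> : \prod_(j < n | j != k) ('X - (y j)%:P).[z^-1] =
   z / z ^+ n * (\prod_(k < n) (1 - z * y k) / (1 - z * y k)).
  under eq_bigr do rewrite !hornerE wy.
  have -> : \prod_(j < n) (1 - z * y j) / (1 - z * y k) =
      \prod_(j < n | j != k) (1 - z * y j).
    by rewrite (bigD1 k)//= mulrAC divff// mul1r.
  rewrite big_split/= mulrC; congr (_ * _).
  have : \prod_(j < n) z^-1 = z ^- n by rewrite prodr_const card_ord exprVn.
  by rewrite (bigD1 k)//= => <-; rewrite mulrA divff// mul1r.
have zn0 : z ^+ n != 0 by rewrite expf_neq0.
by field; rewrite P0 zy zn0 prod_subr_neq0.
Qed.

End PartialFractions.

Section SplineInversion.
Variable R : realType.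
Local Open Scope complex_scope.
Local Open Scope classical_set_scope.

(* With [y k = x_k - t / n] and [z = a + i xi], the partial fractions of
   [z ^+ r / \prod_k (1 - z * y k)] have real numerators, so the real part of
   this function of [xi] integrates to arctangents. *)
Definition spline_primitive (n r : nat) (y : 'I_n -> R) (a T : R) : R :=
  \sum_(k < n) y k ^+ (n - 2 - r) / \prod_(j < n | j != k) (y k - y j)
     * atan (T * (y k / (1 - a * y k))).

Lemma spline_primitive0 n r (y : 'I_n -> R) a : spline_primitive r y a 0 = 0.
Proof. by rewrite /spline_primitive big1// => k _; rewrite mul0r atan0 mulr0. Qed.

Lemma one_sub_neq0 (a xi y : R) : a * y < 1 -> 1 - (a +i* xi) * y%:C != 0.
Proof.
move=> ay; rewrite eq_complex /= negb_and; apply/orP; left.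
by rewrite mulr0 subr0 subr_eq0 eq_sym lt_eqF.
Qed.

(** One factor [y k] is split off the power [n - 1 - r], because [y * Re (1 - z * y)^-1] is the
    xi-derivative of [atan (xi * (y / (1 - a * y)))]. The condition on xi keeps z nonzero when a =
    0. *)
Lemma is_derive_spline_primitive n r (y : 'I_n -> R) (a xi : R) :
  injective y -> (r + 3 <= n)%N -> (forall k, a * y k < 1) -> xi != 0 ->
  is_derive xi 1 (spline_primitive r y a)
    (Re ((a +i* xi) ^+ r / \prod_(k < n) (1 - (a +i* xi) * (y k)%:C))).
Proof.
move=> yI rn ay xi0.
have yCI : injective (fun k => (y k)%:C) by move=> i j /complexI/yI.
rewrite partial_fraction_pow//; first last.
- by move=> k; exact: one_sub_neq0.
- by rewrite eq_complex /= negb_and xi0 orbT.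
- by lia.
rewrite Re_sum; apply: is_derive_sum1 => k.
have ay0 : 1 - a * y k != 0 by rewrite subr_eq0 eq_sym lt_eqF.
have Q0 : \prod_(j < n | j != k) (y k - y j) != 0 by rewrite prod_subr_neq0.
have -> : (y k)%:C ^+ (n - 1 - r) / \prod_(j < n | j != k) ((y k)%:C - (y j)%:C) =
   (y k ^+ (n - 2 - r) / \prod_(j < n | j != k) (y k - y j) * y k)%:C.
  rewrite mulrAC -exprSr rmorphM/= rmorphXn fmorphV rmorph_prod/=.
  congr (_ ^+ _ / _).
    by lia.
  by apply: eq_bigr => j _; rewrite rmorphB.
rewrite ReM_real; set c := _ / _.
apply: is_derive_eq.
have D0 : (1 - a * y k) ^+ 2 + (xi * y k) ^+ 2 != 0.
  by rewrite gt_eqF// ltr_pwDl ?sqr_ge0// exprn_even_gt0.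
have -> : Re (1 - (a +i* xi) * (y k)%:C)^-1 =
   (1 - a * y k) / ((1 - a * y k) ^+ 2 + (xi * y k) ^+ 2).
  by rewrite /= !mulr0 subr0 !add0r sqrrN.
have -> : 1 + (xi * (y k / (1 - a * y k))) ^+ 2 =
    ((1 - a * y k) ^+ 2 + (xi * y k) ^+ 2) / (1 - a * y k) ^+ 2.
  by field; rewrite ay0.
rewrite /GRing.scale/=; move: D0; set D := _ + _ => D0.
by field; rewrite ay0 D0.
Qed.

Lemma cvg_atanZ (c : R) : atan (T * c) @[T --> +oo] --> Num.sg c * (pi / 2).
Proof.
have [c0|c0|->] := ltgtP c 0.
- rewrite ltr0_sg// mulN1r.
  have -> : (fun T => atan (T * c)) = (fun T => - atan (T * - c)).
    by apply/funext => T; rewrite mulrN atanN opprK.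
  apply: cvgN.
  apply: (cvg_comp (fun T => T * - c) (@atan R)); last exact: cvgy_atan.
  by apply: gt0_cvgMly; [rewrite oppr_gt0|exact: cvg_id].
- rewrite gtr0_sg// mul1r.
  apply: (cvg_comp (fun T => T * c) (@atan R)); last exact: cvgy_atan.
  by apply: gt0_cvgMly => //; exact: cvg_id.
- rewrite sgr0 mul0r; under eq_fun do rewrite mulr0 atan0.
  exact: cvg_cst.
Qed.

(** Each arctangent tends to pi/2 times the sign of [y k], since [1 - a * y k] is positive; the
    limit is therefore the same for all admissible a. Truncated powers appear because
    [(1 + sg y) / 2 * y^m = max(y, 0)^m] for m > 0. *)
Lemma cvg_spline_primitive n r (y : 'I_n -> R) (a : R) :
  injective y -> (r + 3 <= n)%N -> (forall k, a * y k < 1) ->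
  spline_primitive r y a T @[T --> +oo] -->
  pi * \sum_(k < n) Num.max (y k) 0 ^+ (n - 2 - r) / \prod_(j < n | j != k) (y k - y j).
Proof.
move=> yI rn ay.
pose e k := y k ^+ (n - 2 - r) / \prod_(j < n | j != k) (y k - y j).
have -> : pi * \sum_(k < n) Num.max (y k) 0 ^+ (n - 2 - r) / \prod_(j < n | j != k) (y k - y j)
  = \sum_(k < n) e k * (Num.sg (y k / (1 - a * y k)) * (pi / 2)).
  (* Since [e] sums to [0], replacing each sign by [1 +] sign costs nothing. *)
  have e0 : \sum_(k < n) e k = 0.
    by apply: sum_pow_div_prod_eq0 => //; lia.
  transitivity (\sum_(k < n) e k * (Num.sg (y k / (1 - a * y k)) * (pi / 2)) +
      pi / 2 * \sum_(k < n) e k); last by rewrite e0 mulr0 addr0.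
  rewrite !mulr_sumr -big_split/=.
  apply: eq_bigr => k _; rewrite /e.
  have -> : Num.sg (y k / (1 - a * y k)) = Num.sg (y k).
    by rewrite sgrM sgrV [Num.sg (1 - _)]gtr0_sg ?mulr1// subr_gt0.
  have m0 : (0 < n - 2 - r)%N by lia.
  have := prod_subr_neq0 k yI; set P := \prod_(j < n | j != k) _ => P0.
  have [y0|y0|y0] := ltgtP (y k) 0.
  + by rewrite ltr0_sg// expr0n eqn0Ngt m0/=; field.
  + by rewrite gtr0_sg//; field.
  + by rewrite y0 sgr0 expr0n eqn0Ngt m0/=; field.
have -> : spline_primitive r y a = fun T => \sum_(k < n) e k * atan (T * (y k / (1 - a * y k))).
  by [].
clearbody e.
elim: (index_enum _) => [|k s ih].
  under eq_fun do rewrite big_nil.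
  by rewrite big_nil; exact: cvg_cst.
under eq_fun do rewrite big_cons.
rewrite big_cons; apply: cvgD; last exact: ih.
by apply: cvgM; [exact: cvg_cst|exact: cvg_atanZ].
Qed.

End SplineInversion.

(** * Primitives on the half line *)

Section GaussianPrimitive.
Variable R : realType.
Local Open Scope complex_scope.
Local Open Scope classical_set_scope.

(** For s = 1 and s = -1 the function [K * atan x - s * D x] is nondecreasing. At 0 only continuity
    is required, the derivative of the spline primitive being known away from 0. *)
Lemma limit_le_of_derive_le (D d : R -> R) (K l : R) :
  D 0 = 0 -> (forall x : R, 0 <= x -> {for x, continuous D}) ->
  (forall x : R, 0 < x -> is_derive x 1 D (d x)) ->
  (forall x : R, 0 < x -> `|d x| <= K / (1 + x ^+ 2)) ->
  D T @[T --> +oo] --> l -> `|l| <= K * (pi / 2).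
Proof.
move=> D0 cD dD hd Dl.
have K0 : 0 <= K.
  have := le_trans (normr_ge0 _) (hd 1 ltr01).
  by rewrite pmulr_lge0// invr_gt0 ltr_pwDl// sqr_ge0.
have H (s T : R) : `|s| = 1 -> 0 <= T -> s * D T <= K * atan T.
  move=> s1 T0.
  pose g x := K * atan x - s * D x.
  have dg (x : R) : 0 < x -> is_derive x 1 g (K * (1 + x ^+ 2)^-1 - s * d x).
    move=> x0; have := is_derive_D1 (is_derive_M1 (is_derive_cst1 K x) (is_derive1_atan x))
      (is_derive_N1 (is_derive_M1 (is_derive_cst1 s x) (dD x x0))).
    by rewrite !mulr0 !addr0.
  have g1 (x : R) : x \in `]0, T[%R -> derivable g x 1.
    by rewrite in_itv/= => /andP[x0 _]; have [] := dg x x0.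
  have g2 (x : R) : x \in `]0, T[%R -> 0 <= g^`() x.
    rewrite in_itv/= => /andP[x0 _]; rewrite derive1E.
    rewrite (@derive_val _ _ _ _ _ _ _ (dg x x0)) subr_ge0.
    apply: le_trans (ler_norm _) _; rewrite normrM s1 mul1r; exact: hd.
  have g3 : {within `[0, T], continuous g}.
    apply/continuous_in_subspaceT => x; rewrite inE/= in_itv/= => /andP[x0 _].
    by apply: cvgB; apply: cvgM; [exact: cvg_cst|exact: continuous_atan|exact: cvg_cst|exact: cD].
  have m0 : 0 \in `[0, T]%R by rewrite in_itv/= lexx.
  have mT : T \in `[0, T]%R by rewrite in_itv/= lexx T0.
  have := ger0_derive1_le_cc g1 g2 g3 m0 mT T0.
  by rewrite /g D0 atan0 !mulr0 subrr subr_ge0.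
have pi2 (T : R) : K * atan T <= K * (pi / 2) by rewrite ler_wpM2l// ltW// atan_ltpi2.
rewrite ler_norml; apply/andP; split.
- apply: (ler_cvg_to (cvg_cst _) Dl); near=> T.
  have T0 : 0 <= T by near: T; exact: nbhs_pinfty_ge.
  have := le_trans (H (-1) T (normrN1 _) T0) (pi2 T).
  by rewrite mulN1r lerNl.
- apply: (ler_cvg_to Dl (cvg_cst _)); near=> T.
  have T0 : 0 <= T by near: T; exact: nbhs_pinfty_ge.
  have := le_trans (H 1 T (normr1 _) T0) (pi2 T).
  by rewrite mul1r.
Unshelve. all: by end_near. Qed.

Lemma gaussian_primitive_exists : exists E : R -> R,
  [/\ E 0 = 0, forall x : R, 0 <= x -> is_derive x 1 E (expR (- x ^+ 2 / 2)) &
     E T @[T --> +oo] --> Num.sqrt (pi / 2)].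
Proof.
pose mu := @lebesgue_measure R.
(* Starting at -1 makes 0 an interior point, so that the derivative at 0 is two-sided. *)
pose J (x : R) : R := (\int[mu]_(u in `[(- 1)%R, x]) gauss_fun u)%R.
have gi a b : mu.-integrable `[a, b] (EFin \o @gauss_fun R).
  apply: continuous_compact_integrable; first exact: segment_compact.
  by apply: continuous_subspaceT; exact: continuous_gauss_fun.
have dJ (x : R) : 0 <= x -> is_derive x 1 J (gauss_fun x).
  move=> x0.
  have [|||h1 h2] := @continuous_FTC1_closed R gauss_fun (-1) x (x + 1) _ (gi _ _).
  - by rewrite ltrDl.
  - by apply: lt_le_trans x0; rewrite ltrN10.
  - exact: continuous_gauss_fun.
  have dv : 'D_1 J x = gauss_fun x by rewrite -derive1E; exact: h2.
  exact: DeriveDef h1 dv.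
have JE (x : R) : 0 <= x -> J x - J 0 = gauss_integral_proof.integral0_gauss x.
  move=> x0; rewrite /J.
  have -> := @Rintegral_itvB R gauss_fun (BLeft (-1)) (BRight x) 0 (gi _ _) _ _; rewrite ?bnd_simp ?lerN10//.
  rewrite Rintegral_itv_obnd_cbnd//.
  by apply: (integrableS _ _ _ (gi 0 x)) => //; exact: subset_itv_oc_cc.
pose c : R := Num.sqrt 2.
have c0 : 0 < c by rewrite sqrtr_gt0.
have c2 : c ^+ 2 = 2 by rewrite sqr_sqrtr.
exists (fun x => c * (J (x / c) - J 0)); split.
- by rewrite mul0r subrr mulr0.
- move=> x x0.
  have xc : 0 <= x / c by rewrite divr_ge0// ltW.
  have h : is_derive x 1 (fun y => J (y / c)) (gauss_fun (x / c) * c^-1).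
    have hc : is_derive x 1 (fun y : R => y / c) (c^-1).
      have := is_derive_M1 (is_derive_id1 x) (is_derive_cst1 c^-1 x).
      by rewrite mulr0 mulr1 add0r.
    exact: (@is_derive_comp1 R J (fun y => y / c) x _ _ (dJ _ xc) hc).
  have := is_derive_M1 (is_derive_cst1 c x) (is_derive_D1 h (is_derive_cst1 (- J 0) x)).
  rewrite mulr0 !addr0 mulrC divfK ?gt_eqF// /gauss_fun.
  by rewrite exprMn exprVn c2 mulNr.
- have -> : Num.sqrt (pi / 2) = c * Num.sqrt (pi / 4) :> R.
    by rewrite -sqrtrM//; congr Num.sqrt; field.
  apply: cvgM; first exact: cvg_cst.
  (* Convergence is known for the square of this nonnegative integral; the square root is
     continuous. *)
  have h : gauss_integral_proof.integral0_gauss x @[x --> +oo] --> Num.sqrt (pi / 4 : R).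
    have : Num.sqrt (@gauss_integral_proof.integral0_gauss R x ^+ 2) @[x --> +oo]
      --> Num.sqrt (pi / 4).
      by apply: continuous_cvg; [exact: sqrt_continuous|exact: gauss_integral_proof.cvg_integral0_gauss_sqr].
    rewrite (_ : (fun _ => Num.sqrt _) = @gauss_integral_proof.integral0_gauss R)//.
    apply/funext => x; rewrite sqrtr_sqr ger0_norm//.
    exact: gauss_integral_proof.integral0_gauss_ge0.
  apply: (@cvg_trans _ (gauss_integral_proof.integral0_gauss (x * c^-1) @[x --> +oo])).
    apply: near_eq_cvg; near=> x.
    by rewrite JE// divr_ge0 ?(ltW c0)//; near: x; exact: nbhs_pinfty_ge.
  apply: (cvg_comp (fun x => x * c^-1) (@gauss_integral_proof.integral0_gauss R)); last exact: h.
  by apply: gt0_cvgMly; [rewrite invr_gt0|exact: cvg_id].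
Unshelve. all: by end_near. Qed.

End GaussianPrimitive.

(** * Hermite polynomials and inversion of the Gaussian kernel *)

Section Hermite.
Variable R : realType.
Local Open Scope complex_scope.
Local Open Scope classical_set_scope.

Fixpoint hermite_poly (r : nat) : {poly R} :=
  if r is r'.+1 then 'X * hermite_poly r' - deriv (hermite_poly r') else 1.

Lemma deriv_hermite_poly r : deriv (hermite_poly r.+1) = r.+1%:R *: hermite_poly r.
Proof.
elim: r => [|r ih].
  by rewrite /= mulr1 -polyC1 derivC subr0 derivX scale1r.
have -> : hermite_poly r.+2 = 'X * hermite_poly r.+1 - deriv (hermite_poly r.+1) by [].
rewrite derivB derivM derivX mul1r !ih derivZ -scalerAr -addrA -scalerBr.
by rewrite -[r.+2%:R]nat1r scalerDl scale1r.
Qed.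

Lemma hermite_polySS r :
  hermite_poly r.+2 = 'X * hermite_poly r.+1 - r.+1%:R *: hermite_poly r.
Proof. by rewrite -deriv_hermite_poly. Qed.

Definition hermite_gauss (r : nat) (t : R) : R :=
  (Num.sqrt (2 * pi))^-1 * (hermite_poly r).[t] * expR (- t ^+ 2 / 2).

Lemma is_derive_horner (p : {poly R}) (x : R) : is_derive x 1 (horner p) (deriv p).[x].
Proof.
by apply: DeriveDef; [exact: derivable_horner|rewrite -derive1E -derivE].
Qed.

Lemma is_derive_hermite_expR r (t : R) :
  is_derive t 1 (fun t : R => (hermite_poly r).[t] * expR (- t ^+ 2 / 2))
    (- ((hermite_poly r.+1).[t] * expR (- t ^+ 2 / 2))).
Proof.
have he : is_derive t 1 (fun t : R => expR (- t ^+ 2 / 2)) (expR (- t ^+ 2 / 2) * - t).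
  have h := is_derive_exp1 (is_derive_M1 (is_derive_N1 (is_derive_X1 2 (is_derive_id1 t)))
     (is_derive_cst1 2^-1 t)).
  by apply: is_derive_eq h _; rewrite /=; field.
apply: is_derive_eq (is_derive_M1 (is_derive_horner _ t) he) _.
by rewrite /= hornerD hornerN hornerM hornerX; ring.
Qed.

Lemma is_derive_hermite_gauss r (t : R) :
  is_derive t 1 (hermite_gauss r) (- hermite_gauss r.+1 t).
Proof.
have h := is_derive_M1 (is_derive_cst1 (Num.sqrt (2 * pi))^-1 t) (is_derive_hermite_expR r t).
have -> : hermite_gauss r = fun t => (Num.sqrt (2 * pi))^-1 * ((hermite_poly r).[t] * expR (- t ^+ 2 / 2)).
  by apply/funext => u; rewrite /hermite_gauss mulrA.
by apply: is_derive_eq h _; rewrite mulr0 addr0 mulrN mulrA.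
Qed.

Lemma derive1n_gauss r (t : R) :
  derive1n r (fun y : R => expR (- y ^+ 2 / 2)) t =
  (-1) ^+ r * ((hermite_poly r).[t] * expR (- t ^+ 2 / 2)).
Proof.
elim: r t => [|r ih] t; first by rewrite /= expr0 mul1r hornerE mul1r.
rewrite derive1nS (_ : derive1n r _ = fun t => (-1) ^+ r * ((hermite_poly r).[t] * expR (- t ^+ 2 / 2))); last first.
  by apply/funext.
rewrite derive1E; have h := is_derive_M1 (is_derive_cst1 ((-1) ^+ r) t) (is_derive_hermite_expR r t).
rewrite (@derive_val _ _ _ _ _ _ _ h) mulr0 addr0 [(-1) ^+ r.+1]exprS.
by ring.
Qed.

Lemma hermite_gaussE r (t : R) :
  (Num.sqrt (2 * pi))^-1 * hermite r t * expR (- t ^+ 2 / 2) = hermite_gauss r t.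
Proof.
rewrite /hermite_gauss -mulrA hermiteE derive1n_gauss.
by rewrite signrMK mulrA.
Qed.

Lemma horner_bound (p : {poly R}) :
  exists2 K : R, 0 <= K & forall t : R, `|p.[t]| <= K * (1 + `|t|) ^+ size p.
Proof.
elim/poly_ind: p => [|p c [K K0 hK]].
  by exists 0 => // t; rewrite horner0 normr0 mul0r.
have [->|p0] := eqVneq p 0.
  exists `|c| => // t; rewrite mul0r add0r hornerC ler_peMr// exprn_ege1//.
  by rewrite lerDl.
exists (K + `|c|); first by rewrite addr_ge0.
move=> t; rewrite size_MXaddC (negbTE p0)/= hornerMXaddC.
have t1 : 1 <= 1 + `|t| by rewrite lerDl.
apply: (le_trans (ler_normD _ _)); rewrite mulrDl lerD//.
  by rewrite normrM exprSr mulrA; apply: ler_pM => //; rewrite lerDr.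
by rewrite ler_peMr// exprn_ege1.
Qed.

Lemma hermite_gauss_bound r p :
  exists2 K : R, 0 < K & forall t : R, `|t| ^+ p * `|hermite_gauss r t| <= K.
Proof.
have [K1 K10 h1] := horner_bound (hermite_poly r).
have [K2 K20 h2] := @pow_le_gauss R (p + size (hermite_poly r)) (1/2) ltac:(lra).
pose c : R := (Num.sqrt (2 * pi))^-1.
have c0 : 0 <= c by rewrite invr_ge0 sqrtr_ge0.
exists (c * K1 * K2 + 1); first by rewrite ltr_wpDl// !mulr_ge0// ltW.
move=> t; apply: (@le_trans _ _ (c * K1 * K2)); last by rewrite lerDl.
rewrite /hermite_gauss -/c !normrM (ger0_norm c0) (ger0_norm (expR_ge0 _)).
have e0 := expR_gt0 (1 / 2 * t ^+ 2 : R).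
have -> : expR (- t ^+ 2 / 2) = (expR (1 / 2 * t ^+ 2))^-1.
  by rewrite -expRN; congr expR; field.
have h : `|t| ^+ p * `|(hermite_poly r).[t]| <= K1 * (K2 * expR (1 / 2 * t ^+ 2)).
  apply: (@le_trans _ _ (`|t| ^+ p * (K1 * (1 + `|t|) ^+ size (hermite_poly r)))).
    by rewrite ler_wpM2l ?exprn_ge0.
  rewrite mulrCA ler_wpM2l//; apply: le_trans (h2 t).
  rewrite exprD ler_wpM2r ?exprn_ge0 ?addr_ge0//.
  by rewrite lerXn2r ?nnegrE ?addr_ge0// lerDr.
move: e0 h; set e := expR _; set H := `|_.[t]|; set T := `|t| ^+ p => e0 h.
have -> : T * (c * H / e) = c * (T * H / e) by ring.
by rewrite -[c * K1 * K2]mulrA; apply: ler_wpM2l => //; rewrite ler_pdivrMr// -mulrA.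
Qed.

(** Real and imaginary part of [d/dxi z^r = i * r * z^(r-1)], proved jointly because their
    recursions in r are coupled. For r = 0 the truncated exponent [r.-1] is harmless, being
    multiplied by [r%:R]. *)
Lemma is_derive_ReIm_pow (t xi : R) (r : nat) :
  is_derive xi 1 (fun x => Re ((t +i* x) ^+ r)) (- (r%:R * Im ((t +i* xi) ^+ r.-1))) /\
  is_derive xi 1 (fun x => Im ((t +i* x) ^+ r)) (r%:R * Re ((t +i* xi) ^+ r.-1)).
Proof.
have reS n x : Re ((t +i* x) ^+ n.+1) = t * Re ((t +i* x) ^+ n) - x * Im ((t +i* x) ^+ n).
  by rewrite exprS; case: (_ ^+ n).
have imS n x : Im ((t +i* x) ^+ n.+1) = t * Im ((t +i* x) ^+ n) + x * Re ((t +i* x) ^+ n).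
  by rewrite exprS; case: (_ ^+ n).
elim: r => [|r [ih1 ih2]].
  by rewrite !mul0r oppr0; split; exact: is_derive_cst1.
have reE : r%:R * Re ((t +i* xi) ^+ r) =
    r%:R * (t * Re ((t +i* xi) ^+ r.-1) - xi * Im ((t +i* xi) ^+ r.-1)).
  by case: r {ih1 ih2} => [|r]; rewrite ?mul0r// reS.
have imE : r%:R * Im ((t +i* xi) ^+ r) =
    r%:R * (t * Im ((t +i* xi) ^+ r.-1) + xi * Re ((t +i* xi) ^+ r.-1)).
  by case: r {ih1 ih2 reE} => [|r]; rewrite ?mul0r// imS.
split.
- rewrite (_ : (fun x => _) = fun x => t * Re ((t +i* x) ^+ r) - x * Im ((t +i* x) ^+ r)); last exact/funext.
  have h := is_derive_D1 (is_derive_M1 (is_derive_cst1 t xi) ih1)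
    (is_derive_N1 (is_derive_M1 (is_derive_id1 xi) ih2)).
  by apply: is_derive_eq h _; rewrite -[r.+1%:R]natr1 mulrDl imE; ring.
- rewrite (_ : (fun x => _) = fun x => t * Im ((t +i* x) ^+ r) + x * Re ((t +i* x) ^+ r)); last exact/funext.
  have h := is_derive_D1 (is_derive_M1 (is_derive_cst1 t xi) ih2)
    (is_derive_M1 (is_derive_id1 xi) ih1).
  by apply: is_derive_eq h _; rewrite -[r.+1%:R]natr1 mulrDl reE; ring.
Qed.

(* On the saddle-point line [z = t + i xi] the exponent [- z * t + z ^+ 2 / 2]
   is the real number [- t ^+ 2 / 2 - xi ^+ 2 / 2]. *)
Definition gauss_transform_primitive (t : R) (r : nat) (B : R -> R) :=
  [/\ B 0 = 0,
      forall x : R, 0 <= x ->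
        is_derive x 1 B (Re ((t +i* x) ^+ r) * expR (- x ^+ 2 / 2)) &
      B T @[T --> +oo] --> Num.sqrt (pi / 2) * (hermite_poly r).[t]].

(** Boundary term of an integration by parts. [pow_le_gauss] is applied with one power more than r,
    and the surplus [1 + |T|] forces the limit 0. *)
Lemma cvg_Im_pow_gauss (t : R) (r : nat) :
  Im ((t +i* T) ^+ r) * expR (- T ^+ 2 / 2) @[T --> +oo] --> 0.
Proof.
have [K K0 hK] := @pow_le_gauss R r.+1 (1/2) ltac:(lra).
pose C := (1 + `|t|) ^+ r * K.
have C0 : 0 < C by rewrite mulr_gt0 ?exprn_gt0// ltr_pwDl.
apply/cvgr0Pnorm_le => e e0; near=> T.
have T0 : 0 < T by near: T; exact: nbhs_pinfty_gt.
have TC : C / e <= T by near: T; apply: nbhs_pinfty_ge; exact: num_real.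
have E0 := expR_gt0 (1 / 2 * T ^+ 2 : R).
have -> : expR (- T ^+ 2 / 2) = (expR (1 / 2 * T ^+ 2))^-1.
  by rewrite -expRN; congr expR; field.
rewrite normrM normfV (ger0_norm (ltW E0)) ler_pdivrMr//.
have h1 : `|Im ((t +i* T) ^+ r)| <= (1 + `|t|) ^+ r * (1 + `|T|) ^+ r.
  apply: le_trans (Im_le_normc _) _; rewrite normcX -exprMn.
  rewrite lerXn2r ?nnegrE ?normc_ge0 ?mulr_ge0 ?addr_ge0//.
  apply: le_trans (normc_le_ReIm _) _ => /=.
  by have := mulr_ge0 (normr_ge0 t) (normr_ge0 T); lra.
have Tp : 0 < 1 + `|T| by rewrite ltr_pwDl.
suff : `|Im ((t +i* T) ^+ r)| * (1 + `|T|) <= e * expR (1 / 2 * T ^+ 2) * (1 + `|T|).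
  by rewrite ler_pM2r.
apply: (@le_trans _ _ (C * expR (1 / 2 * T ^+ 2))).
  rewrite /C -mulrA; apply: le_trans (ler_wpM2l _ (hK T)); last by rewrite exprn_ge0// addr_ge0.
  by rewrite exprSr mulrA ler_wpM2r// ltW.
rewrite [leRHS]mulrAC ler_wpM2r ?expR_ge0// -ler_pdivrMl// mulrC.
by apply: le_trans TC _; rewrite (gtr0_norm T0) lerDr.
Unshelve. all: by end_near. Qed.

(** The classical formula He_r(t) = E (t + i N)^r for a standard normal N. Integrating
    [xi * Im z^(r+1)] against the Gaussian by parts gives the three-term recurrence of the Hermite
    polynomials, so the induction carries two consecutive orders. *)
Lemma gauss_transform_primitive_exists (t : R) (r : nat) :
  exists B, gauss_transform_primitive t r B.
Proof.
have [E [E0 dE cE]] := gaussian_primitive_exists R.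
have [] // : [/\ exists B, gauss_transform_primitive t r B
           & exists B, gauss_transform_primitive t r.+1 B].
elim: r => [|r [[B [B0 dB cB]] [B' [B'0 dB' cB']]]].
  split; first by exists E; split=> //= [x x0|]; rewrite ?mul1r ?hornerE ?mulr1//; exact: dE.
  exists (fun x => t * E x); split.
  - by rewrite E0 mulr0.
  - move=> x x0; rewrite expr1/=.
    by apply: is_derive_eq (is_derive_M1 (is_derive_cst1 t x) (dE x x0)) _; rewrite mulr0 addr0.
  - rewrite /= mulr1 -polyC1 derivC subr0 hornerX mulrC.
    by apply: cvgM; [exact: cvg_cst|exact: cE].
split; first by exists B'; split.
exists (fun x => t * B' x - r.+1%:R * B x + Im ((t +i* x) ^+ r.+1) * expR (- x ^+ 2 / 2)); split.
- rewrite B0 B'0 !mulr0 subrr add0r.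
  have -> : (t +i* 0) ^+ r.+1 = (t ^+ r.+1)%:C :> R[i] by rewrite rmorphXn.
  by rewrite /= mul0r.
- move=> x x0.
  have he : is_derive x 1 (fun t : R => expR (- t ^+ 2 / 2)) (expR (- x ^+ 2 / 2) * - x).
    have h := is_derive_exp1 (is_derive_M1 (is_derive_N1 (is_derive_X1 2 (is_derive_id1 x)))
       (is_derive_cst1 2^-1 x)).
    by apply: is_derive_eq h _; rewrite /=; field.
  have h := is_derive_D1 (is_derive_D1 (is_derive_M1 (is_derive_cst1 t x) (dB' x x0))
    (is_derive_N1 (is_derive_M1 (is_derive_cst1 r.+1%:R x) (dB x x0))))
    (is_derive_M1 (is_derive_ReIm_pow t x r.+1).2 he).
  apply: is_derive_eq h _; rewrite [_ ^+ r.+2]exprS.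
  by case: ((t +i* x) ^+ r.+1) => u v /=; case: ((t +i* x) ^+ r) => u' v' /=; ring.
- rewrite hermite_polySS hornerD hornerN hornerM hornerX hornerZ mulrBr.
  rewrite -[X in _ --> X]addr0; apply: cvgD; last exact: cvg_Im_pow_gauss.
  rewrite [X in X - _]mulrCA [X in _ - X]mulrCA.
  by apply: cvgB; apply: cvgM; [exact: cvg_cst|exact: cB'|exact: cvg_cst|exact: cB].
Qed.

End Hermite.

(** * Comparison of the kernels *)

Section KernelEstimates.
Variable R : realType.
Local Open Scope complex_scope.

(** With [p = z * (x - s)] and [q = z^2 * x^2 / 2], both factors begin with 1 + p. Their
    second-order terms [q + p^2/2] and [p^2] differ only because x stands in q where x - s stands in
    p, which yields the first error term; all the rest is cubic in H. *)
Lemma factor_difference (t s x xi : R) : `|t * x| <= 1/20 -> 0 <= t * s ->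
  normc (cexp ((t +i* xi) * (x - s)%:C + (t +i* xi) ^+ 2 * (x ^+ 2 / 2)%:C)
         - (1 - (t +i* xi) * (x - s)%:C)^-1)
  <= normc (t +i* xi) ^+ 2 * (`|x| * `|s| + s ^+ 2)
     + 384 * (normc (t +i* xi) * (`|x| + `|s|)) ^+ 3.
Proof.
move=> tx ts.
have Hre1 : 19/20 <= Re (1 - (t +i* xi) * (x - s)%:C).
  by move: tx; rewrite /= mulr0 subr0 ler_norml => /andP[_ tx]; lra.
have HreW : Re ((t +i* xi) * (x - s)%:C + (t +i* xi) ^+ 2 * (x ^+ 2 / 2)%:C) <= 1.
  rewrite expr2 /= !mulr0 !subr0.
  have h : (t * x) ^+ 2 <= 1/400 by rewrite -real_normK ?num_real//; have := normr_ge0 (t * x); nra.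
  have h2 : 0 <= (xi * x) ^+ 2 by exact: sqr_ge0.
  by move: tx; rewrite ler_norml => /andP[_ tx]; nra.
move: Hre1 HreW; set z := t +i* xi; set Z := normc z.
have Z0 : 0 <= Z := normc_ge0 _.
set h := `|x| + `|s|; set H := Z * h.
have x0 := normr_ge0 x; have s0 := normr_ge0 s.
have h0 : 0 <= h by rewrite addr_ge0.
have H0 : 0 <= H by rewrite mulr_ge0.
set p := z * (x - s)%:C; set q := z ^+ 2 * (x ^+ 2 / 2)%:C.
move=> Hre1 HreW.
have E0 : 0 <= Z ^+ 2 * (`|x| * `|s| + s ^+ 2).
  by rewrite mulr_ge0 ?sqr_ge0// addr_ge0 ?sqr_ge0// mulr_ge0.
have pH : normc p <= H.
  rewrite normcM normc_real ler_wpM2l//.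
  exact: ler_normB.
have qH : normc q <= H ^+ 2 / 2.
  rewrite normcM normcX normc_real ger0_norm ?divr_ge0 ?sqr_ge0//.
  rewrite mulrA ler_pM2r// exprMn ler_wpM2l ?sqr_ge0//.
  rewrite -[x ^+ 2]real_normK ?num_real// lerXn2r ?nnegrE//.
  by rewrite lerDl.
have p1 : 1 - p != 0.
  by apply/eqP => e; move: Hre1; rewrite e /=; lra.
(* Taylor expansion serves [H <= 1/4]. Otherwise the trivial bound 4 + 2 is at most [384 * H ^+ 3],
   and this case fixes the constant 384. *)
have [Hs|Hb] := leP H (1/4); last first.
  have ha : normc (cexp (p + q)) <= 4.
    by rewrite normc_cexp (le_trans _ (@expR1_le4 R))// ler_expR.
  have hb : normc (1 - p)^-1 <= 2.
    rewrite normcV -[2]invrK lef_pV2 ?posrE ?invr_gt0 ?normc_gt0//.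
    by apply: le_trans (Re_le_normc _); apply: le_trans (ler_norm _); lra.
  have h6 : 6 <= 384 * H ^+ 3.
    have : (1/4) ^+ 3 <= H ^+ 3 by rewrite lerXn2r ?nnegrE// ltW.
    by lra.
  by have := le_trans (normcB _ _) (lerD ha hb); lra.
have W1 : normc (p + q) <= 9/8 * H.
  by apply: (le_trans (normcD _ _)); nra.
have W1' : normc (p + q) <= 1 by lra.
have T3 := cexp_taylor3 W1'.
have hb : normc (1 - p)^-1 <= 4/3.
  rewrite normcV -[4/3]invrK lef_pV2 ?posrE ?invr_gt0 ?normc_gt0//.
  have : normc (1 : R[i]) <= normc (1 - p) + normc p.
    by rewrite -[X in normc X <= _](subrK p) normcD.
  by rewrite normc1; lra.
have -> : cexp (p + q) - (1 - p)^-1 =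
   (cexp (p + q) - 1 - (p + q) - (p + q) ^+ 2 / 2) + (q - p ^+ 2 / 2)
   + (p * q + q ^+ 2 / 2) - p ^+ 3 / (1 - p).
  by field.
have b1 : normc (cexp (p + q) - 1 - (p + q) - (p + q) ^+ 2 / 2) <= 46 * H ^+ 3.
  apply: (le_trans T3); apply: (@le_trans _ _ (32 * (9/8 * H) ^+ 3)).
    by rewrite ler_wpM2l// lerXn2r ?nnegrE ?normc_ge0// mulr_ge0.
  rewrite exprMn; have : 0 <= H ^+ 3 by rewrite exprn_ge0.
  by lra.
have n2 : normc (2 : R[i]) = 2.
  have -> : (2 : R[i]) = (2 : R)%:C by rewrite rmorph_nat.
  by rewrite normc_real ger0_norm.
have b2 : normc (q - p ^+ 2 / 2) <= Z ^+ 2 * (`|x| * `|s| + s ^+ 2).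
  have -> : q - p ^+ 2 / 2 = z ^+ 2 * ((x ^+ 2 - (x - s) ^+ 2) / 2)%:C.
    have e2 : (x - s)%:C ^+ 2 / 2 = ((x - s) ^+ 2 / 2)%:C.
      by rewrite rmorphM rmorphXn fmorphV rmorph_nat.
    have -> : p ^+ 2 / 2 = z ^+ 2 * ((x - s) ^+ 2 / 2)%:C by rewrite -e2 /p; ring.
    by rewrite /q -mulrBr -rmorphB mulrBl.
  rewrite normcM normcX normc_real ler_wpM2l ?sqr_ge0//.
  have -> : (x ^+ 2 - (x - s) ^+ 2) / 2 = x * s - s ^+ 2 / 2 by field.
  apply: (le_trans (ler_normB _ _)); rewrite normrM lerD2l ger0_norm.
    by have := sqr_ge0 s; lra.
  by rewrite divr_ge0 ?sqr_ge0.
have b3 : normc (p * q + q ^+ 2 / 2) <= H ^+ 3.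
  apply: (le_trans (normcD _ _)); rewrite (normcM p) (normcM (q ^+ 2)) normcX normcV n2.
  have q0 := normc_ge0 q; have p0 := normc_ge0 p.
  have c1 : normc p * normc q <= H * (H ^+ 2 / 2) by rewrite ler_pM.
  have c2 : normc q ^+ 2 <= (H ^+ 2 / 2) ^+ 2 by rewrite lerXn2r ?nnegrE// divr_ge0// sqr_ge0.
  have c3 : H ^+ 4 <= H ^+ 3 / 4.
    by rewrite exprSr ler_wpM2l ?exprn_ge0//; lra.
  have : 0 <= H ^+ 3 by rewrite exprn_ge0.
  have -> : H ^+ 3 = H * H ^+ 2 by rewrite exprS.
  move: c2 c3; rewrite exprMn -exprM [H ^+ 3]exprS.
  by move: c1; lra.
have b4 : normc (p ^+ 3 / (1 - p)) <= H ^+ 3 * (4/3).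
  rewrite normcM normcX ler_pM ?exprn_ge0 ?normc_ge0//.
  by rewrite lerXn2r ?nnegrE ?normc_ge0.
apply: (le_trans (normcB _ _)); apply: (le_trans (lerD (normcD _ _) (lexx _))).
apply: (le_trans (lerD (lerD (normcD _ _) (lexx _)) (lexx _))).
have H3 : 0 <= H ^+ 3 by rewrite exprn_ge0.
by lra.
Qed.

(** Splitting at [|x k| = 2 * L] gives [x^2 <= |x|^3 / (2 * L) + 4 * L^2], whose sum is
    [1 <= 1/2 + 4 * n * L^2]. Splitting at L gives [|x| <= x^2 / L + L], whose mean is at most
    [8 * L + L]. *)
Lemma sum_sqr_cube (n : nat) (x : 'I_n -> R) (L : R) :
  \sum_(k < n) x k ^+ 2 = 1 -> \sum_(k < n) `|x k| ^+ 3 = L ->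
  [/\ 0 < L, 1 <= 8 * n%:R * L ^+ 2 & L <= 1 -> \sum_(k < n) `|x k| / n%:R <= 9 * L].
Proof.
move=> x2 x3.
have n0 : 0 < n%:R :> R.
  rewrite ltr0n; case: n x x2 x3 => // x; rewrite big_ord0 => /esym/eqP.
  by rewrite oner_eq0.
have L0 : 0 < L.
  rewrite lt_neqAle; apply/andP; split; last first.
    by rewrite -x3; apply: sumr_ge0 => k _; rewrite exprn_ge0.
  apply/eqP => L0; move: x3; rewrite -L0 => /psumr_eq0P h.
  have : \sum_(k < n) x k ^+ 2 = 0.
    apply: big1 => k _; have /eqP := h (fun i _ => exprn_ge0 3 (normr_ge0 (x i))) k isT.
    by rewrite expf_eq0/= normr_eq0 => /eqP->; rewrite expr0n.
  by rewrite x2 => /eqP; rewrite oner_eq0.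
have nL : 1 <= 8 * n%:R * L ^+ 2.
  have : \sum_(k < n) x k ^+ 2 <= \sum_(k < n) (`|x k| ^+ 3 / (2 * L) + 4 * L ^+ 2).
    apply: ler_sum => k _; have := normr_ge0 (x k); rewrite -real_normK ?num_real//.
    move: `|x k| => v v0.
    have [v2|v2] := leP v (2 * L).
      apply: (@le_trans _ _ ((2 * L) ^+ 2)); first by rewrite lerXn2r ?nnegrE// mulr_ge0// ltW.
      by rewrite exprMn -natrX lerDr divr_ge0 ?exprn_ge0// mulr_ge0// ltW.
    apply: (@le_trans _ _ (v ^+ 3 / (2 * L))); last first.
      by rewrite lerDl mulr_ge0// sqr_ge0.
    by rewrite ler_pdivlMr ?mulr_gt0// [v ^+ 3]exprSr ler_wpM2l ?sqr_ge0// ltW.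
  rewrite x2 big_split/= -mulr_suml x3 sumr_const card_ord -[_ *+ n]mulr_natl.
  have -> : L / (2 * L) = 1/2 by field; rewrite gt_eqF.
  by lra.
split=> // L1.
have : \sum_(k < n) `|x k| / n%:R <= \sum_(k < n) (x k ^+ 2 / L + L) / n%:R.
  apply: ler_sum => k _; rewrite ler_wpM2r ?invr_ge0 ?(ltW n0)//.
  have := normr_ge0 (x k); rewrite -real_normK ?num_real//; move: `|x k| => v v0.
  have [vL|vL] := leP v L; first by rewrite (le_trans vL)// lerDr divr_ge0 ?sqr_ge0// ltW.
  apply: (@le_trans _ _ (v ^+ 2 / L)); last by rewrite lerDl ltW.
  by rewrite ler_pdivlMr// expr2 ler_wpM2l// ltW.
move/le_trans; apply.
rewrite -mulr_suml big_split/= -mulr_suml x2 sumr_const card_ord -[_ *+ n]mulr_natl.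
have -> : (1 / L + n%:R * L) / n%:R = 1 / L / n%:R + L by field; rewrite !gt_eqF.
have : 1 / L / n%:R <= 8 * L.
  by rewrite !ler_pdivrMr//; apply: le_trans nL _; rewrite expr2; lra.
by lra.
Qed.

(** Every power of [s = t / n] brings a factor 1/n, and [1/n <= 8 * L^2] turns the sums into
    multiples of L. The constant 4 comes from [(v + w)^3 <= 4 * (v^3 + w^3)], and 64 from
    [1/n^2]. *)
Lemma sum_factor_difference (n : nat) (x : 'I_n -> R) (L t Z c : R) :
  \sum_(k < n) x k ^+ 2 = 1 -> \sum_(k < n) `|x k| ^+ 3 = L -> L <= 1 -> 0 <= Z -> 0 <= c ->
  \sum_(k < n) (Z ^+ 2 * (`|x k| * `|t / n%:R| + (t / n%:R) ^+ 2)
     + c * (Z * (`|x k| + `|t / n%:R|)) ^+ 3)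
  <= (3 + 4 * 64 * c) * (1 + Z) ^+ 3 * (1 + `|t|) ^+ 3 * L.
Proof.
move=> x2 x3 L1 Z0 c0; have [L0 nL xn] := sum_sqr_cube x2 x3; move/(_ L1) in xn.
have n0 : 0 < n%:R :> R.
  by rewrite lt_neqAle ler0n andbT eq_sym; apply/eqP => n0; move: nL; rewrite n0; lra.
have ni : n%:R^-1 <= 8 * L ^+ 2.
  by rewrite -[n%:R^-1]mul1r ler_pdivrMr// mulrAC.
have nip : 0 < n%:R^-1 :> R by rewrite invr_gt0.
have L2 : L ^+ 2 <= L by rewrite expr2 ler_piMl// ltW.
have T0 := normr_ge0 t; set T := `|t| in T0 *.
have sE : `|t / n%:R| = T / n%:R by rewrite normrM [X in _ * X]gtr0_norm.
have s2E : (t / n%:R) ^+ 2 = T ^+ 2 / n%:R ^+ 2.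
  by rewrite exprMn exprVn /T real_normK ?num_real.
apply: (@le_trans _ _ (\sum_(k < n) (Z ^+ 2 * (T * (`|x k| / n%:R) + T ^+ 2 / n%:R ^+ 2)
     + 4 * c * Z ^+ 3 * (`|x k| ^+ 3 + T ^+ 3 / n%:R ^+ 3)))).
  apply: ler_sum => k _; rewrite sE s2E; apply: lerD.
    by rewrite ler_wpM2l ?sqr_ge0// lerD2r mulrCA mulrA.
  rewrite exprMn mulrA.
  have -> : 4 * c * Z ^+ 3 * (`|x k| ^+ 3 + T ^+ 3 / n%:R ^+ 3) =
     c * Z ^+ 3 * (4 * (`|x k| ^+ 3 + (T / n%:R) ^+ 3)).
    by rewrite exprMn exprVn; ring.
  rewrite ler_wpM2l//; first by rewrite mulr_ge0// exprn_ge0.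
  have v0 := normr_ge0 (x k); have w0 : 0 <= T / n%:R by rewrite divr_ge0// ltW.
  move: v0 w0; move: `|x k| (T / n%:R) => v w v0 w0.
  have : 0 <= (v + w) * (v - w) ^+ 2 by rewrite mulr_ge0 ?sqr_ge0// addr_ge0.
  by nra.
rewrite big_split/= -!mulr_sumr !big_split/= -mulr_sumr x3 !sumr_const card_ord.
rewrite -[(T ^+ 2 / _) *+ n]mulr_natl -[(T ^+ 3 / _) *+ n]mulr_natl.
have -> : n%:R * (T ^+ 2 / n%:R ^+ 2) = T ^+ 2 * n%:R^-1 by field; rewrite gt_eqF.
have -> : n%:R * (T ^+ 3 / n%:R ^+ 3) = T ^+ 3 * (n%:R^-1 * n%:R^-1) by field; rewrite gt_eqF.
have e1 : T * (\sum_(i < n) `|x i| / n%:R) <= T * (9 * L) by rewrite ler_wpM2l.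
have e2 : T ^+ 2 * n%:R^-1 <= T ^+ 2 * (8 * L) by rewrite ler_wpM2l ?sqr_ge0//; lra.
have e3 : T ^+ 3 * (n%:R^-1 * n%:R^-1) <= T ^+ 3 * (64 * L).
  rewrite ler_wpM2l ?exprn_ge0//.
  have : n%:R^-1 * n%:R^-1 <= (8 * L) * 8 by rewrite ler_pM ?(ltW nip)//; lra.
  by lra.
have f1 : Z ^+ 2 * (T * (\sum_(i < n) `|x i| / n%:R) + T ^+ 2 * n%:R^-1) <=
   Z ^+ 2 * (T * (9 * L) + T ^+ 2 * (8 * L)) by rewrite ler_wpM2l ?sqr_ge0// lerD.
have f2 : 4 * c * Z ^+ 3 * (L + T ^+ 3 * (n%:R^-1 * n%:R^-1)) <=
   4 * c * Z ^+ 3 * (L + T ^+ 3 * (64 * L)).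
  by rewrite ler_wpM2l ?lerD2l// mulr_ge0 ?exprn_ge0// mulr_ge0.
apply: (le_trans (lerD f1 f2)).
have -> : Z ^+ 2 * (T * (9 * L) + T ^+ 2 * (8 * L)) +
    4 * c * Z ^+ 3 * (L + T ^+ 3 * (64 * L)) =
    (Z ^+ 2 * (9 * T + 8 * T ^+ 2) + 4 * c * Z ^+ 3 * (1 + 64 * T ^+ 3)) * L by ring.
rewrite ler_wpM2r ?(ltW L0)//.
have z2 : Z ^+ 2 <= (1 + Z) ^+ 3 by have := exprn_ge0 3 Z0; nra.
have z3 : Z ^+ 3 <= (1 + Z) ^+ 3 by rewrite lerXn2r ?nnegrE ?addr_ge0// lerDr.
have t2 : 9 * T + 8 * T ^+ 2 <= 3 * (1 + T) ^+ 3 by have := exprn_ge0 3 T0; nra.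
have t3 : 1 + 64 * T ^+ 3 <= 64 * (1 + T) ^+ 3 by have := exprn_ge0 3 T0; nra.
have g1 : Z ^+ 2 * (9 * T + 8 * T ^+ 2) <= (1 + Z) ^+ 3 * (3 * (1 + T) ^+ 3).
  by rewrite ler_pM// ?sqr_ge0// addr_ge0// mulr_ge0// sqr_ge0.
have g2 : Z ^+ 3 * (1 + 64 * T ^+ 3) <= (1 + Z) ^+ 3 * (64 * (1 + T) ^+ 3).
  by rewrite ler_pM// ?exprn_ge0// addr_ge0// mulr_ge0// exprn_ge0.
have g3 := ler_wpM2l c0 g2.
by lra.
Qed.

End KernelEstimates.

Section KernelBounds.
Variable R : realType.
Local Open Scope complex_scope.

(* A common lower bound for the inverse moduli of the Gaussian and the spline
   factor at the knot [x]; [k] is a surrogate for [x ^+ 2] and [(x - s) ^+ 2]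
   whose total over the knots gives the decay in [xi]. *)
Definition knot_weight (a s xi x k : R) : R :=
  (1 - 4/5 * (a * x) ^+ 2) * (1 + 19/20 * (a * s)) * Num.sqrt (1 + xi ^+ 2 * k).

Lemma sqr_le_of_norm_le (u b : R) : `|u| <= b -> u ^+ 2 <= b ^+ 2.
Proof.
by move=> ub; rewrite -real_normK ?num_real// lerXn2r ?nnegrE// (le_trans _ ub).
Qed.

Lemma knot_weight_factor_ge0 (a s x : R) : `|a * x| <= 1/20 -> 0 <= a * s ->
  0 < (1 - 4/5 * (a * x) ^+ 2) * (1 + 19/20 * (a * s)).
Proof.
by move=> /sqr_le_of_norm_le ax as0; rewrite mulr_gt0//; nra.
Qed.

Lemma sqr_knot_weight (a s xi x k : R) : 0 <= k ->
  knot_weight a s xi x k ^+ 2 =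
  ((1 - 4/5 * (a * x) ^+ 2) * (1 + 19/20 * (a * s))) ^+ 2 * (1 + xi ^+ 2 * k).
Proof. by move=> k0; rewrite exprMn sqr_sqrtr// addr_ge0// mulr_ge0// sqr_ge0. Qed.

Lemma knot_weight_gt0 (a s xi x k : R) : `|a * x| <= 1/20 -> 0 <= a * s ->
  0 <= k -> 0 < knot_weight a s xi x k.
Proof.
move=> ax as0 k0; rewrite mulr_gt0 ?knot_weight_factor_ge0// sqrtr_gt0.
by rewrite ltr_pwDl// mulr_ge0// sqr_ge0.
Qed.

Lemma knot_weight_le_spline (a s xi x k : R) : `|a * x| <= 1/20 ->
  0 <= a * s <= 1/20 -> 0 <= k <= (x - s) ^+ 2 / 8 ->
  knot_weight a s xi x k <= expR (a * x) * normc (1 - (a +i* xi) * (x - s)%:C).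
Proof.
move=> ax /andP[as0 as1] /andP[k0 k1].
have q0 := ltW (knot_weight_gt0 xi ax as0 k0).
rewrite -(@ler_pXn2r _ 2)// ?nnegrE// ?mulr_ge0 ?expR_ge0 ?normc_ge0//.
apply: le_trans (spline_factor_ge _ ax _); last by rewrite as0.
rewrite sqr_knot_weight// ler_wpM2l ?sqr_ge0// lerD2l ler_wpM2l//.
exact: sqr_ge0.
Qed.

Lemma knot_weight_le_gauss (a s xi x k : R) : `|a * x| <= 1/20 ->
  0 <= a * s <= 1/20 -> 0 <= k <= x ^+ 2 ->
  knot_weight a s xi x k <= expR (a * s - (a * x) ^+ 2 / 2 + xi ^+ 2 * x ^+ 2 / 2).
Proof.
move=> ax /andP[as0 as1] /andP[k0 k1].
have q0 := ltW (knot_weight_gt0 xi ax as0 k0).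
rewrite -(@ler_pXn2r _ 2)// ?nnegrE ?expR_ge0//.
apply: le_trans (gauss_factor_ge _ ax _); last by rewrite as0.
rewrite sqr_knot_weight// ler_wpM2l ?sqr_ge0// lerD2l ler_wpM2l//.
exact: sqr_ge0.
Qed.

(** In the telescoped sum each difference of factors keeps its own weight; bounding that weight
    costs one power of [1 + |xi|]. *)
Lemma knot_weight_le (a s xi x k : R) : `|a * x| <= 1/20 ->
  0 <= a * s <= 1/20 -> 0 <= k <= 1 -> knot_weight a s xi x k <= 2 * (1 + `|xi|).
Proof.
move=> ax /andP[as0 as1] /andP[k0 k1].
rewrite /knot_weight; apply: ler_pM; rewrite ?sqrtr_ge0//.
- exact: ltW (knot_weight_factor_ge0 ax as0).
- by have := sqr_ge0 (a * x); move/sqr_le_of_norm_le: ax; nra.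
- rewrite -[leRHS]ger0_norm ?addr_ge0// -sqrtr_sqr ler_wsqrtr//.
  have := normr_ge0 xi; have := sqr_ge0 xi; rewrite -[xi ^+ 2]real_normK ?num_real//.
  by move: `|xi| => v; nra.
Qed.

(** The three parts of the weight are multiplied separately. For [v <= 1/400] one has
    [1 - 4/5 v >= expR (- 17/20 v)], and the [(a * x j)^2] add up to [a^2]. The square roots are
    squared before [prod_ge_pow] is applied, whence the 2 in [2 * m]. *)
Lemma prod_knot_weight_ge (n m : nat) (x k : 'I_n -> R) (a s xi c : R) :
  \sum_(j < n) x j ^+ 2 = 1 -> (forall j, `|a * x j| <= 1/20) -> 0 <= a * s ->
  0 < c -> xi != 0 -> (forall j, 0 <= k j <= c) ->
  (2 * m)%:R * c <= \sum_(j < n) k j ->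
  expR (- (17/20 * a ^+ 2)) * (1 + 19/20 * (a * s)) ^+ n * (1 + xi ^+ 2 * c) ^+ m
  <= \prod_(j < n) knot_weight a s xi (x j) (k j).
Proof.
move=> x2 ax as0 c0 xi0 kc ks.
rewrite !big_split/= prodr_const card_ord.
have xi2 : 0 < xi ^+ 2 by rewrite lt_neqAle eq_sym sqrf_eq0 xi0 sqr_ge0.
have w0 : 0 <= (1 + 19/20 * (a * s)) ^+ n.
  by rewrite exprn_ge0// addr_ge0// mulr_ge0.
apply: ler_pM.
- by rewrite mulr_ge0// expR_ge0.
- by rewrite exprn_ge0// addr_ge0// mulr_ge0 ?(ltW xi2) ?(ltW c0).
- rewrite ler_wpM2r//.
  have -> : - (17/20 * a ^+ 2) = \sum_(j < n) - (17/20 * (a * x j) ^+ 2).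
    rewrite sumrN -mulr_sumr; congr (- (_ * _)).
    by under eq_bigr do rewrite exprMn; rewrite -mulr_sumr x2 mulr1.
  rewrite expR_sum; apply: ler_prod => j _; rewrite expR_ge0/=.
  have := sqr_le_of_norm_le (ax j); have := sqr_ge0 (a * x j).
  move: ((a * x j) ^+ 2) => v v0 v1.
  have v2 : 0 < 1 - 4/5 * v by lra.
  rewrite expRN -[leRHS]invrK lef_pV2 ?posrE ?expR_gt0 ?invr_gt0//.
  rewrite -[_^-1]mul1r ler_pdivrMr//.
  have := expR_ge1Dx (17/20 * v); move: (expR _) => e he.
  by nra.
- have P0 : 0 <= \prod_(j < n) Num.sqrt (1 + xi ^+ 2 * k j).
    by apply: prodr_ge0 => i _; rewrite sqrtr_ge0.
  have A0 : 0 <= (1 + xi ^+ 2 * c) ^+ m.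
    by rewrite exprn_ge0// addr_ge0// mulr_ge0// ltW.
  rewrite -(@ler_pXn2r _ 2)//.
  rewrite -exprM mulnC -prodrXl.
  rewrite [leRHS](eq_bigr (fun j => 1 + xi ^+ 2 * k j)); last first.
    move=> i _; have /andP[kj _] := kc i.
    by rewrite sqr_sqrtr// addr_ge0// mulr_ge0 ?(ltW xi2).
  apply: prod_ge_pow; first by rewrite mulr_gt0.
    move=> i; have /andP[k0 k1] := kc i.
    by rewrite mulr_ge0 ?(ltW xi2)//= ler_pM2l.
  by rewrite -mulr_sumr mulrCA ler_pM2l.
Qed.

Lemma normc_prod_one_sub (n : nat) (x : 'I_n -> R) (a s xi : R) :
  \sum_(j < n) x j = 0 ->
  normc (\prod_(j < n) (1 - (a +i* xi) * (x j - s)%:C)) =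
  \prod_(j < n) (expR (a * x j) * normc (1 - (a +i* xi) * (x j - s)%:C)).
Proof.
move=> x0; rewrite normc_prod big_split.
by rewrite -(expR_sum _ (fun j => a * x j)) -mulr_sumr x0 mulr0 expR0 /= mul1r.
Qed.

Lemma normc_spline_kernel_ge (n m : nat) (x k : 'I_n -> R) (a s xi c : R) :
  \sum_(j < n) x j = 0 ->
  \sum_(j < n) x j ^+ 2 = 1 -> (forall j, `|a * x j| <= 1/20) -> 0 <= a * s <= 1/20 ->
  0 < c -> xi != 0 -> (forall j, 0 <= k j <= c) ->
  (forall j, k j <= (x j - s) ^+ 2 / 8) ->
  (2 * m)%:R * c <= \sum_(j < n) k j ->
  expR (- (17/20 * a ^+ 2)) * (1 + 19/20 * (a * s)) ^+ n * (1 + xi ^+ 2 * c) ^+ m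
  <= normc (\prod_(j < n) (1 - (a +i* xi) * (x j - s)%:C)).
Proof.
move=> x1 x2 ax as01 c0 xi0 kc ky ks; have /andP[as0 as1] := as01.
apply: (le_trans (prod_knot_weight_ge x2 ax as0 c0 xi0 kc ks)).
rewrite normc_prod_one_sub//; apply: ler_prod => j _; have /andP[k0 _] := kc j.
by rewrite ltW ?knot_weight_gt0//= knot_weight_le_spline ?k0 ?ky.
Qed.

(** [normc_prod_sub] is applied to the Gaussian factors A and the spline factors B, both multiplied
    by [expR (- (t * x j))], whose product over the knots is 1. The decay on the left is the product
    of the knot weights. *)
Lemma kernel_difference : exists2 V : R, 0 < V &
  forall (n m : nat) (x k : 'I_n -> R) (t xi c L : R),
  \sum_(j < n) x j = 0 ->
  \sum_(j < n) x j ^+ 2 = 1 -> \sum_(j < n) `|x j| ^+ 3 = L -> L <= 1 ->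
  (forall j, `|t * x j| <= 1/20) -> t * (t / n%:R) <= 1/20 ->
  0 < c <= 1 -> xi != 0 -> (forall j, 0 <= k j <= c) ->
  (forall j, k j <= (x j - t / n%:R) ^+ 2 / 8) -> (forall j, k j <= x j ^+ 2) ->
  (2 * m)%:R * c <= \sum_(j < n) k j ->
  expR (t ^+ 2 / 20) * (1 + xi ^+ 2 * c) ^+ m *
  normc ((expR (- t ^+ 2 / 2) * expR (- xi ^+ 2 / 2))%:C
         - (\prod_(j < n) (1 - (t +i* xi) * (x j - t / n%:R)%:C))^-1)
  <= V * (1 + `|xi|) * (1 + normc (t +i* xi)) ^+ 3 * (1 + `|t|) ^+ 3 * L.
Proof.
(* Here 8 = 2 * 4, with 2 from [knot_weight_le] and 4 from the bound on [expR (- (t * x j))]; the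
   bracket is the constant of [sum_factor_difference] for c = 384. *)
exists (8 * (3 + 4 * 64 * 384)); first by lra.
move=> n m x k t xi c L.
move=> x1 x2 x3 L1 tx tn /andP[c0 c1] xi0 kc ky kx ks.
have [L0 nL _] := sum_sqr_cube x2 x3.
have n0 : 0 < n%:R :> R.
  by rewrite lt_neqAle ler0n andbT eq_sym; apply/eqP => n0; move: nL; rewrite n0; lra.
have tn0 : 0 <= t * (t / n%:R) by rewrite mulrA divr_ge0// -?expr2 ?sqr_ge0 ?ltW.
have tn01 : 0 <= t * (t / n%:R) <= 1/20 by rewrite tn0.
set s := t / n%:R in ky tn tn0 tn01 *.
set z := t +i* xi.
pose A (j : 'I_n) : R[i] := cexp (z * (x j - s)%:C + z ^+ 2 * (x j ^+ 2 / 2)%:C)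
   * (expR (- (t * x j)))%:C.
pose B (j : 'I_n) : R[i] := (1 - z * (x j - s)%:C)^-1 * (expR (- (t * x j)))%:C.
pose Q (j : 'I_n) : R := knot_weight t s xi (x j) (k j).
have k0 j : 0 <= k j by have /andP[] := kc j.
have Q0 j : 0 < Q j by exact: knot_weight_gt0.
have QA j : Q j * normc (A j) <= 1.
  rewrite /A normcM normc_cexp normc_real ger0_norm ?expR_ge0// -expRD.
  rewrite -[leRHS](mulfV (lt0r_neq0 (expR_gt0 (t * s - (t * x j) ^+ 2 / 2 + xi ^+ 2 * x j ^+ 2 / 2)))).
  apply: ler_pM; rewrite ?expR_ge0 ?(ltW (Q0 j))//.
    by apply: knot_weight_le_gauss => //; rewrite k0 kx.
  rewrite -expRN ler_expR expr2 /= !mulr0 !subr0.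
  by rewrite le_eqVlt; apply/orP; left; apply/eqP; field.
have QB j : Q j * normc (B j) <= 1.
  rewrite /B normcM normcV normc_real ger0_norm ?expR_ge0// expRN -invfM.
  have h : Q j <= expR (t * x j) * normc (1 - z * (x j - s)%:C).
    by apply: knot_weight_le_spline => //; rewrite k0 ky.
  by rewrite [X in Q j * X^-1]mulrC ler_pdivrMr ?mul1r// (lt_le_trans (Q0 j)).
have eSx : \prod_(j < n) (expR (- (t * x j)))%:C = 1 :> R[i].
  by rewrite -rmorph_prod/= -expR_sum sumrN -mulr_sumr x1 mulr0 oppr0 expR0.
have eS : \sum_(j < n) (x j - s) = - t.
  by rewrite big_split/= x1 sumrN sumr_const card_ord -mulr_natr /s divfK ?gt_eqF// add0r.
have PA : \prod_(j < n) A j = (expR (- t ^+ 2 / 2) * expR (- xi ^+ 2 / 2))%:C.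
  rewrite /A big_split/= eSx mulr1 -cexp_sum -expRD -cexp_real; congr cexp.
  rewrite big_split/= -!mulr_sumr -!rmorph_sum/= -mulr_suml x2 eS.
  rewrite /z expr2; apply/eqP; rewrite eq_complex /=.
  by apply/andP; split; apply/eqP; field.
have PB : \prod_(j < n) B j = (\prod_(j < n) (1 - z * (x j - s)%:C))^-1.
  by rewrite /B big_split/= eSx mulr1 prodfV.
have := normc_prod_sub (index_enum 'I_n) Q0 QA QB.
rewrite PA PB => h.
have Qge : expR (t ^+ 2 / 20) * (1 + xi ^+ 2 * c) ^+ m <= \prod_(j < n) Q j.
  apply: le_trans (prod_knot_weight_ge x2 tx tn0 c0 xi0 kc ks).
  rewrite ler_wpM2r//.
    by rewrite exprn_ge0// addr_ge0// mulr_ge0 ?sqr_ge0 ?ltW.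
  (* For w in [0, 1/20] one has [expR (9/10 w) <= 1 + 19/20 w], and the gain [9/10 t^2] exceeds the
     loss [17/20 t^2] by exactly [t^2 / 20]. *)
  apply: (@le_trans _ _ (expR (- (17/20 * t ^+ 2)) * expR (9/10 * (t * s)) ^+ n)).
    rewrite -expRM_natl -expRD ler_expR.
    have -> : n%:R * (9/10 * (t * s)) = 9/10 * t ^+ 2.
      by rewrite /s; field; rewrite gt_eqF.
    by lra.
  rewrite ler_wpM2l ?expR_ge0// lerXn2r ?nnegrE ?expR_ge0//.
    by rewrite addr_ge0// mulr_ge0.
  move: (t * s) tn0 tn {tn01} => w w0 w1.
  have w2 : 0 < 1 - 9/10 * w by lra.
  have : expR (9/10 * w) <= (1 - 9/10 * w)^-1.
    rewrite -[leLHS]invrK -expRN lef_pV2 ?posrE ?expR_gt0//.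
    exact: expR_ge1Dx.
  by move/le_trans; apply; rewrite -[_^-1]mul1r ler_pdivrMr//; nra.
apply: (le_trans (ler_wpM2r (normc_ge0 _) Qge)); apply: (le_trans h).
have Z0 := normc_ge0 z.
have c384 : 0 <= 384 :> R by rewrite ler0n.
have := @sum_factor_difference R n x L t _ 384 x2 x3 L1 Z0 c384; rewrite -/s => hs.
set V := 3 + _ in hs *.
have -> : 8 * V * (1 + `|xi|) * (1 + normc z) ^+ 3 * (1 + `|t|) ^+ 3 * L =
  (2 * (1 + `|xi|) * 4) * (V * (1 + normc z) ^+ 3 * (1 + `|t|) ^+ 3 * L) by ring.
apply: (@le_trans _ _ ((2 * (1 + `|xi|) * 4) * \sum_(k0 < n)
       (normc z ^+ 2 * (`|x k0| * `|s| + s ^+ 2) +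
        384 * (normc z * (`|x k0| + `|s|)) ^+ 3))); last first.
  by rewrite ler_wpM2l// mulr_ge0// mulr_ge0// addr_ge0.
rewrite mulr_sumr; apply: ler_sum => j _; rewrite -mulrA.
apply: ler_pM; rewrite ?normc_ge0 ?(ltW (Q0 j))//.
  apply: knot_weight_le => //; rewrite k0 (le_trans _ c1)//.
  by have /andP[] := kc j.
rewrite /A /B -mulrBl normcM mulrC normc_real ger0_norm ?expR_ge0//.
apply: ler_pM; rewrite ?normc_ge0 ?expR_ge0//; last exact: factor_difference.
apply: le_trans (@expR1_le4 R); rewrite ler_expR.
by have := tx j; rewrite ler_norml => /andP[+ _]; lra.
Qed.

(** [2 / c * (1 + c * xi^2)] dominates both [1 + |xi|] and [1 + xi^2]. The last of the Q.+1 factors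
    pays for [1 + xi^2], as the comparison with the arctangent requires. *)
Lemma pow_le_kernel (Q : nat) (c xi : R) : 0 < c <= 1 ->
  (1 + `|xi|) ^+ Q * (1 + xi ^+ 2) <= (2 / c) ^+ Q.+1 * (1 + xi ^+ 2 * c) ^+ Q.+1.
Proof.
case/andP=> c0 c1; have v0 := normr_ge0 xi.
have v2 : `|xi| ^+ 2 = xi ^+ 2 by rewrite real_normK ?num_real.
have e : 2 / c * (1 + xi ^+ 2 * c) = 2 / c + 2 * xi ^+ 2 by field; rewrite gt_eqF.
have c2 : 2 <= 2 / c by rewrite ler_pdivlMr//; lra.
have h0 : 0 <= 2 / c * (1 + xi ^+ 2 * c) by rewrite e; have := sqr_ge0 xi; lra.
rewrite -exprMn [leRHS]exprSr; apply: ler_pM; rewrite ?exprn_ge0 ?addr_ge0 ?sqr_ge0//.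
  rewrite lerXn2r ?nnegrE ?addr_ge0//.
  by rewrite e -v2; move: `|xi| v0 => v v0; have := sqr_ge0 (v - 1); nra.
by rewrite e; have := sqr_ge0 xi; lra.
Qed.

End KernelBounds.

(** * Central range and tail *)

Section SplineEstimates.
Variable R : realType.
Local Open Scope complex_scope.
Local Open Scope classical_set_scope.

Definition spline_sum (n r : nat) (x : 'I_n -> R) (t : R) : R :=
  \sum_(k < n) Num.max (x k - t / n%:R) 0 ^+ (n - 2 - r)
    / \prod_(j < n | j != k) (x k - x j).

Lemma spline_sum_shift n r (x : 'I_n -> R) (t : R) :
  spline_sum r x t =
  \sum_(k < n) Num.max (x k - t / n%:R) 0 ^+ (n - 2 - r)
    / \prod_(j < n | j != k) ((x k - t / n%:R) - (x j - t / n%:R)).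
Proof.
apply: eq_bigr => k _; congr (_ / _); apply: eq_bigr => j _.
by ring.
Qed.

Lemma continuous_spline_primitive n r (y : 'I_n -> R) (a x : R) :
  {for x, continuous (spline_primitive r y a)}.
Proof.
by apply: is_derive_continuous; apply: is_derive_sum1.
Qed.

Lemma normc_le_add (t xi : R) : 1 + normc (t +i* xi) <= (1 + `|t|) * (1 + `|xi|).
Proof.
have := normc_le_ReIm (t +i* xi); have := mulr_ge0 (normr_ge0 t) (normr_ge0 xi).
by rewrite /=; lra.
Qed.

Lemma pi_hermite_gauss r (t : R) :
  expR (- t ^+ 2 / 2) * (Num.sqrt (pi / 2) * (hermite_poly R r).[t]) =
  pi * hermite_gauss r t.
Proof.
rewrite /hermite_gauss.
move: (pi_gt0 R); move: (pi : R) => q q0.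
have s0 : 0 < Num.sqrt (2 * q) by rewrite sqrtr_gt0 mulr_gt0.
have -> : Num.sqrt (q / 2) = q / Num.sqrt (2 * q).
  have e : q / 2 = (q / Num.sqrt (2 * q)) ^+ 2.
    by rewrite exprMn exprVn sqr_sqrtr ?mulr_ge0 ?(ltW q0)//; field; rewrite gt_eqF.
  by rewrite e sqrtr_sqr ger0_norm// divr_ge0 ?(ltW q0) ?(ltW s0).
by ring.
Qed.

Lemma spline_sum_central (p r : nat) : exists2 K : R, 0 < K &
  exists2 eta : R, 0 < eta &
  forall (n : nat) (x : 'I_n -> R) (L X t : R), (r + 3 <= n)%N -> injective x ->
    \sum_(j < n) x j = 0 -> \sum_(j < n) x j ^+ 2 = 1 ->
    \sum_(j < n) `|x j| ^+ 3 = L -> L <= 1 ->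
    (forall j, `|x j| <= X) -> X <= eta -> `|t| * X <= 1/20 ->
    `|t| ^+ p * `|hermite_gauss r t - spline_sum r x t| <= K * L.
Proof.
(* The exponent r + 4 collects r from z^r, 3 from the cubic error and 1 from the weight; one more
   power makes the bound integrable. The value of c makes [2 * m * c] equal to 1/32. *)
pose m := (r + 4).+1; pose c : R := (64 * m)%:R^-1.
have m0 : 0 < m%:R :> R by rewrite ltr0n.
have c0 : 0 < c by rewrite invr_gt0 natrM mulr_gt0.
have c1 : c <= 1 by rewrite invf_le1 ?natrM ?mulr_gt0// -natrM ler1n.
have [K2 K20 hK2] := @pow_le_gauss R (p + (r + 6)) (1/20) ltac:(lra).
have [V V0 KD] := kernel_difference R.
exists (V * (2 / c) ^+ m * K2).
  by rewrite !mulr_gt0// exprn_gt0// divr_gt0.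
exists c => // n x L X t rn xI x1 x2 x3 L1 xX Xc tX.
have [L0 _ _] := sum_sqr_cube x2 x3.
have npos : (0 < n)%N by rewrite (leq_trans _ rn)// addn3.
have n0 : 0 < n%:R :> R by rewrite ltr0n.
have X0 : 0 <= X by exact: le_trans (normr_ge0 _) (xX (Ordinal npos)).
have xX2 j : x j ^+ 2 <= X ^+ 2 by exact: sqr_le_of_norm_le.
(* Since 1 = sum x_j^2 <= n X^2, the product [t * s = t^2 / n] is at most (|t| X)^2. *)
have nX : n%:R^-1 <= X ^+ 2.
  have := ler_sum (index_enum 'I_n) (fun j (_ : true) => xX2 j).
  rewrite x2 sumr_const card_ord -[X ^+ 2 *+ _]mulr_natr => h.
  by rewrite -[n%:R^-1]mul1r ler_pdivrMr.
set s := t / n%:R.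
have ts2 : t * s <= 1/400.
  have -> : t * s = `|t| ^+ 2 * n%:R^-1 by rewrite real_normK ?num_real// /s mulrA expr2.
  apply: (@le_trans _ _ (`|t| ^+ 2 * X ^+ 2)); first by rewrite ler_wpM2l// sqr_ge0.
  by rewrite -exprMn; have := mulr_ge0 (normr_ge0 t) X0; nra.
have ts0 : 0 <= t * s by rewrite /s mulrA -expr2 divr_ge0 ?sqr_ge0// ltW.
have tx j : `|t * x j| <= 1/20.
  by rewrite normrM (le_trans _ tX)// ler_wpM2l.
pose y j := x j - s.
(* An admissible surrogate for both kernels at once. Its sum is at least 1/32, because [(x - s)^2]
   exceeds [x^2 / 2 - s^2] by [(x - 2 s)^2 / 2] and n s^2 = t s is small. *)
pose k j := Num.min (x j ^+ 2) (y j ^+ 2) / 8.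
have k0 j : 0 <= k j by rewrite divr_ge0// le_min !sqr_ge0.
have kx j : k j <= x j ^+ 2 / 8 by rewrite ler_wpM2r// ge_min lexx.
have ky j : k j <= (x j - s) ^+ 2 / 8 by rewrite ler_wpM2r// ge_min lexx orbT.
have XX : X ^+ 2 <= c.
  by rewrite expr2 (le_trans _ Xc)// ler_piMl// (le_trans Xc).
have kc j : 0 <= k j <= c.
  by rewrite k0/=; have := kx j; have := xX2 j; have := sqr_ge0 (x j); lra.
have kx' j : k j <= x j ^+ 2 by have := kx j; have := sqr_ge0 (x j); lra.
have ks : (2 * m)%:R * c <= \sum_(j < n) k j.
  have -> : (2 * m)%:R * c = 1/32.
    by rewrite /c !natrM; field; rewrite gt_eqF.
  have : \sum_(j < n) (x j ^+ 2 / 16 - s ^+ 2 / 8) <= \sum_(j < n) k j.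
    apply: ler_sum => j _; rewrite /k.
    have : x j ^+ 2 / 2 - s ^+ 2 <= Num.min (x j ^+ 2) (y j ^+ 2).
      rewrite le_min; apply/andP; split.
        by have := sqr_ge0 (x j); have := sqr_ge0 s; lra.
      by rewrite /y; have := sqr_ge0 (x j - 2 * s); lra.
    by lra.
  rewrite big_split/= -mulr_suml x2 sumrN sumr_const card_ord -[(s ^+ 2 / 8) *+ _]mulr_natr.
  have -> : s ^+ 2 / 8 * n%:R = t * s / 8 by rewrite /s; field; rewrite gt_eqF.
  by lra.
have ts : t * (t / n%:R) <= 1/20 by rewrite -/s; lra.
have c01 : 0 < c <= 1 by rewrite c0.
have yI : injective y by move=> i j /addIr/xI.
have ty j : t * y j < 1.
  by rewrite /y mulrBr; have := tx j; rewrite ler_norml => /andP[_]; lra.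
have [B [B0 dB cB]] := gauss_transform_primitive_exists t r.
pose D xi := expR (- t ^+ 2 / 2) * B xi - spline_primitive r y t xi.
pose W (xi : R) := (expR (- t ^+ 2 / 2) * expR (- xi ^+ 2 / 2))%:C
         - (\prod_(j < n) (1 - (t +i* xi) * (y j)%:C))^-1.
have Dl : D T @[T --> +oo] --> pi * (hermite_gauss r t - spline_sum r x t).
  rewrite mulrBr -pi_hermite_gauss spline_sum_shift; apply: cvgB.
    by apply: cvgM; [exact: cvg_cst|exact: cB].
  exact: cvg_spline_primitive.
have dD (xi : R) : 0 < xi -> is_derive xi 1 D (Re ((t +i* xi) ^+ r * W xi)).
  move=> xi0; have h := is_derive_D1
    (is_derive_M1 (is_derive_cst1 (expR (- t ^+ 2 / 2)) xi) (dB xi (ltW xi0)))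
    (is_derive_N1 (is_derive_spline_primitive yI rn ty (lt0r_neq0 xi0))).
  apply: is_derive_eq h _; rewrite /W mulrBr ReD ReN [_ ^+ r * _%:C]mulrC ReM_real.
  by ring.
have E0 := expR_gt0 (t ^+ 2 / 20).
have tt : 0 <= 1 + `|t| by rewrite addr_ge0.
have cm : 0 <= (2 / c) ^+ m by rewrite exprn_ge0// divr_ge0// ltW.
pose K1 := V * (2 / c) ^+ m * (1 + `|t|) ^+ (r + 6) * L / expR (t ^+ 2 / 20).
have hd (xi : R) : 0 < xi -> `|Re ((t +i* xi) ^+ r * W xi)| <= K1 / (1 + xi ^+ 2).
  move=> xi0; apply: (le_trans (Re_le_normc _)).
  have := KD n m x k t xi c L x1 x2 x3 L1 tx ts c01 (lt0r_neq0 xi0) kc ky kx' ks.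
  have pk := @pow_le_kernel R (r + 4) c xi c01.
  have zz := normc_le_add t xi.
  rewrite normcM normcX -/(W xi) ler_pdivlMr ?ltr_pwDl ?sqr_ge0// /K1 ler_pdivlMr//.
  move: (normc_ge0 (t +i* xi)) (normc_ge0 (W xi)) zz.
  set Z := normc (t +i* xi); set N := normc (W xi) => Z0 N0 zz h.
  have vv : 0 <= 1 + `|xi| by rewrite addr_ge0.
  have q0 : 0 < 1 + xi ^+ 2 * c by rewrite ltr_pwDl// mulr_ge0 ?sqr_ge0 ?ltW.
  have Zr : Z ^+ r * (1 + Z) ^+ 3 <= (1 + `|t|) ^+ (r + 3) * (1 + `|xi|) ^+ (r + 3).
    rewrite -exprMn; apply: (@le_trans _ _ ((1 + Z) ^+ (r + 3))).
      rewrite exprD ler_wpM2r ?exprn_ge0 ?addr_ge0//.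
      by rewrite lerXn2r ?nnegrE ?addr_ge0// lerDr.
    by rewrite lerXn2r ?nnegrE ?mulr_ge0 ?addr_ge0//.
  have qm : 0 < (1 + xi ^+ 2 * c) ^+ m by rewrite exprn_gt0.
  rewrite -(ler_pM2r qm).
  have x20 : 0 <= 1 + xi ^+ 2 by rewrite addr_ge0 ?sqr_ge0.
  have s1 := ler_wpM2l (mulr_ge0 (exprn_ge0 r Z0) x20) h.
  have -> : Z ^+ r * N * (1 + xi ^+ 2) * expR (t ^+ 2 / 20) * (1 + xi ^+ 2 * c) ^+ m =
     Z ^+ r * (1 + xi ^+ 2) * (expR (t ^+ 2 / 20) * (1 + xi ^+ 2 * c) ^+ m * N) by ring.
  apply: (le_trans s1).
  have f0 : 0 <= V * (1 + `|xi|) * (1 + `|t|) ^+ 3 * L * (1 + xi ^+ 2).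
    exact: mulr_ge0 (mulr_ge0 (mulr_ge0 (mulr_ge0 (ltW V0) vv) (exprn_ge0 3 tt)) (ltW L0)) x20.
  have -> : Z ^+ r * (1 + xi ^+ 2) * (V * (1 + `|xi|) * (1 + Z) ^+ 3 * (1 + `|t|) ^+ 3 * L)
    = V * (1 + `|xi|) * (1 + `|t|) ^+ 3 * L * (1 + xi ^+ 2) * (Z ^+ r * (1 + Z) ^+ 3) by ring.
  apply: (le_trans (ler_wpM2l f0 Zr)).
  have g0 : 0 <= V * (1 + `|t|) ^+ (r + 6) * L.
    exact: mulr_ge0 (mulr_ge0 (ltW V0) (exprn_ge0 _ tt)) (ltW L0).
  have -> : V * (1 + `|xi|) * (1 + `|t|) ^+ 3 * L * (1 + xi ^+ 2) *
     ((1 + `|t|) ^+ (r + 3) * (1 + `|xi|) ^+ (r + 3)) =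
     V * (1 + `|t|) ^+ (r + 6) * L * ((1 + `|xi|) ^+ (r + 4) * (1 + xi ^+ 2)).
    have -> : (1 + `|t|) ^+ (r + 6) = (1 + `|t|) ^+ 3 * (1 + `|t|) ^+ (r + 3).
      by rewrite -exprD addnCA.
    have -> : (1 + `|xi|) ^+ (r + 4) = (1 + `|xi|) * (1 + `|xi|) ^+ (r + 3).
      by rewrite -exprS -addnS.
    by move: ((1 + `|t|) ^+ (r + 3)) ((1 + `|xi|) ^+ (r + 3)) => b1 b2; ring.
  apply: (le_trans (ler_wpM2l g0 pk)).
  rewrite -/m; move: ((2 / c) ^+ m) ((1 + xi ^+ 2 * c) ^+ m) ((1 + `|t|) ^+ (r + 6)) => b1 b2 b3.
  by rewrite le_eqVlt; apply/orP; left; apply/eqP; ring.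
have Dcont (xi : R) : 0 <= xi -> {for xi, continuous D}.
  move=> xi0; apply: cvgB; last exact: continuous_spline_primitive.
  apply: cvgM; first exact: cvg_cst.
  exact: (is_derive_continuous (dB xi xi0)).
have D0 : D 0 = 0 by rewrite /D B0 spline_primitive0 mulr0 subrr.
have := limit_le_of_derive_le D0 Dcont dD hd Dl.
have p0 : 0 < (pi : R) := pi_gt0 R.
rewrite normrM (gtr0_norm p0) mulrCA ler_pM2l// => h.
apply: (le_trans (ler_wpM2l (exprn_ge0 p (normr_ge0 t)) h)).
have K10 : 0 <= K1.
  apply: mulr_ge0; last by rewrite invr_ge0 expR_ge0.
  exact: mulr_ge0 (mulr_ge0 (mulr_ge0 (ltW V0) cm) (exprn_ge0 _ tt)) (ltW L0).
apply: (@le_trans _ _ ((1 + `|t|) ^+ p * K1)).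
  apply: ler_pM; rewrite ?exprn_ge0//; first by rewrite mulr_ge0// invr_ge0.
    by rewrite lerXn2r ?nnegrE ?addr_ge0// lerDr.
  by rewrite ler_piMr//; lra.
rewrite /K1 !mulrA ler_pdivrMr//.
have -> : (1 + `|t|) ^+ p * V * (2 / c) ^+ m * (1 + `|t|) ^+ (r + 6) * L =
   V * (2 / c) ^+ m * L * (1 + `|t|) ^+ (p + (r + 6)).
  by rewrite [_ ^+ (p + _)]exprD; ring.
have -> : V * (2 / c) ^+ m * K2 * L * expR (t ^+ 2 / 20) =
   V * (2 / c) ^+ m * L * (K2 * expR (t ^+ 2 / 20)) by ring.
rewrite ler_wpM2l//; last first.
  by have := hK2 t; rewrite (_ : 1 / 20 * t ^+ 2 = t ^+ 2 / 20)//; field.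
exact: mulr_ge0 (mulr_ge0 (ltW V0) cm) (ltW L0).
Qed.

End SplineEstimates.

Section SplineTail.
Variable R : realType.
Local Open Scope complex_scope.
Local Open Scope classical_set_scope.

(** Here t/n lies outside the range of the knots. On the right every truncated power vanishes; on
    the left none is truncated, and the sum is a divided difference of a polynomial of too low
    degree. *)
Lemma spline_sum_eq0 (n r : nat) (x : 'I_n -> R) (X t : R) :
  (r + 3 <= n)%N -> injective x -> (forall j, `|x j| <= X) -> X < `|t / n%:R| ->
  spline_sum r x t = 0.
Proof.
move=> rn xI xX Xs; set s := t / n%:R in Xs.
have m0 : (0 < n - 2 - r)%N by lia.
rewrite spline_sum_shift -/s; have [s0|s0] := leP 0 s.
  apply: big1 => k _; rewrite max_r ?expr0n ?(gtn_eqF m0) ?mul0r//.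
  rewrite ger0_norm// in Xs.
  by have := xX k; rewrite ler_norml => /andP[_]; lra.
rewrite -[RHS](@sum_pow_div_prod_eq0 _ n (n - 2 - r) (fun j => x j - s)).
- apply: eq_bigr => k _; rewrite max_l//; rewrite ltr0_norm// in Xs.
  by have := xX k; rewrite ler_norml => /andP[+ _]; lra.
- by move=> i j /addIr/xI.
- by lia.
Qed.

(** Monotonicity of (1 + v/n)^n in n, from [prod_ge_pow] with equal factors; afterwards the 1 in
    [1 + v / P] is dropped. *)
Lemma compound_ge (n P : nat) (v : R) : (0 < P)%N -> (P <= n)%N -> 0 < v ->
  (v / P%:R) ^+ P <= (1 + v / n%:R) ^+ n.
Proof.
move=> P0 Pn v0; have P0' : 0 < P%:R :> R by rewrite ltr0n.
have n0 : 0 < n%:R :> R by rewrite ltr0n (leq_trans P0).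
apply: (@le_trans _ _ ((1 + v / P%:R) ^+ P)).
  by rewrite lerXn2r ?nnegrE ?addr_ge0 ?divr_ge0 ?(ltW v0) ?(ltW P0')// lerDr.
have := @prod_ge_pow R 'I_n (index_enum 'I_n) (fun=> v / n%:R) (v / P%:R) P.
rewrite prodr_const card_ord; apply.
- by rewrite divr_gt0.
- move=> _; rewrite divr_ge0 ?(ltW v0) ?(ltW n0)//=.
  by rewrite ler_pM2l// lef_pV2 ?posrE// ler_nat.
- rewrite sumr_const card_ord -[(v / n%:R) *+ n]mulr_natl.
  by rewrite [leLHS]mulrC [leRHS]mulrC !divfK ?gt_eqF.
Qed.

Lemma spline_sum_tail (p r : nat) : exists2 K : R, 0 < K &
  exists2 eta : R, 0 < eta &
  forall (n : nat) (x : 'I_n -> R) (L X t : R),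
    (r + 3 <= n)%N -> (p + 3 <= n)%N -> injective x ->
    \sum_(j < n) x j = 0 -> \sum_(j < n) x j ^+ 2 = 1 ->
    (forall j, `|x j| <= X) -> X ^+ 3 <= L -> X <= eta -> 1/20 < `|t| * X ->
    `|t| ^+ p * `|spline_sum r x t| <= K * L.
Proof.
(* On the line |Re z| = 1 only z^r grows with xi, so one power more than r suffices. P = p + 3
   supplies the powers of |t| that are traded for L. *)
pose m := r.+1; pose c : R := (64 * m)%:R^-1; pose P := (p + 3)%N.
have m0 : 0 < m%:R :> R by rewrite ltr0n.
have c0 : 0 < c by rewrite invr_gt0 natrM mulr_gt0.
have c64 : c <= 1/64.
  rewrite div1r /c natrM lef_pV2 ?posrE ?mulr_gt0// ler_peMr//.
  by rewrite ler1n.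
have c1 : c <= 1 by lra.
have P0 : 0 < P%:R :> R by rewrite ltr0n /P addn3.
pose b : R := 19/20 / P%:R.
have b0 : 0 < b by rewrite divr_gt0.
have bP : 0 < b ^+ P by rewrite exprn_gt0.
have e0 := expR_gt0 (- (17/20) : R); move: e0; set e := expR _ => e0.
have cm : 0 < (2 / c) ^+ m by rewrite exprn_gt0// divr_gt0.
pose G : R := 2 ^+ r * (2 / c) ^+ m / e.
have G0 : 0 < G by rewrite divr_gt0// mulr_gt0// exprn_gt0.
exists (G * 20 ^+ 3 / b ^+ P).
  by apply: divr_gt0 => //; apply: mulr_gt0 => //; rewrite exprn_gt0.
exists c => // n x L X t rn pn xI x1 x2 xX XL Xc tX.
have npos : (0 < n)%N by rewrite (leq_trans _ rn)// addn3.
have n0 : 0 < n%:R :> R by rewrite ltr0n.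
have X0 : 0 <= X by exact: le_trans (normr_ge0 _) (xX (Ordinal npos)).
have L0 : 0 <= L by rewrite (le_trans _ XL)// exprn_ge0.
have [sX|sX] := leP `|t / n%:R| X; last first.
  rewrite (spline_sum_eq0 rn xI xX sX) normr0 mulr0 mulr_ge0//.
  by rewrite divr_ge0 ?(ltW bP)// mulr_ge0 ?(ltW G0)// exprn_ge0.
have t0 : 0 < `|t|.
  by rewrite lt_neqAle normr_ge0 andbT; apply: contraTneq tX => <-; rewrite mul0r; lra.
have tn0 : t != 0 by rewrite -normr_gt0.
set s := t / n%:R in sX.
(* The sign makes [a * s] nonnegative, and |a| = 1 keeps [a * x j] within 1/20, which the saddle
   point t need not do in this range. *)
pose a : R := Num.sg t.
have a1 : `|a| = 1 by rewrite normr_sg tn0.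
have a2 : a ^+ 2 = 1 by rewrite -real_normK ?num_real// a1 expr1n.
have asE : a * s = `|s|.
  by rewrite /s /a mulrA -normrEsg [in RHS]normrM normfV [`|n%:R|]gtr0_norm.
have as01 : 0 <= a * s <= 1/20 by rewrite asE normr_ge0/=; lra.
have ax j : `|a * x j| <= 1/20 by rewrite normrM a1 mul1r; have := xX j; lra.
pose y j := x j - s.
pose k j := y j ^+ 2 / 8.
have XX : X ^+ 2 <= c by rewrite expr2 (le_trans _ Xc)// ler_piMl// (le_trans Xc).
have kc j : 0 <= k j <= c.
  rewrite divr_ge0 ?sqr_ge0//= /k.
  have : y j ^+ 2 <= (2 * X) ^+ 2.
    apply: sqr_le_of_norm_le; apply: (le_trans (ler_normB _ _)).
    by have := xX j; lra.
  by rewrite exprMn; lra.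
have ks : (2 * m)%:R * c <= \sum_(j < n) k j.
  have -> : (2 * m)%:R * c = 1/32 by rewrite /c !natrM; field; rewrite gt_eqF.
  rewrite /k -mulr_suml.
  suff : 1 <= \sum_(j < n) y j ^+ 2 by lra.
  have -> : \sum_(j < n) y j ^+ 2 = \sum_(j < n) (x j ^+ 2 + (- (2 * s) * x j + s ^+ 2)).
    by apply: eq_bigr => j _; rewrite /y; ring.
  rewrite big_split/= x2 big_split/= -mulr_sumr x1 mulr0 add0r lerDl.
  by apply: sumr_ge0 => j _; rewrite sqr_ge0.
have yI : injective y by move=> i j /addIr/xI.
have ay j : a * y j < 1.
  rewrite /y mulrBr; case/andP: as01 => as0 _.
  by have := ax j; rewrite ler_norml => /andP[_]; lra.
pose T := (1 + 19/20 * (a * s)) ^+ n.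
have TP : b ^+ P * `|t| ^+ P <= T.
  have := @compound_ge n P (19/20 * `|t|); rewrite -exprMn /b.
  have -> : 19/20 / P%:R * `|t| = 19/20 * `|t| / P%:R by rewrite mulrAC.
  have -> : T = (1 + 19/20 * `|t| / n%:R) ^+ n.
    by rewrite /T asE /s normrM normfV [`|n%:R|]gtr0_norm// mulrA.
  by apply=> //; [rewrite /P addn3|rewrite mulr_gt0].
have T0 : 0 < T by rewrite (lt_le_trans _ TP)// mulr_gt0// exprn_gt0.
pose K1 := 2 ^+ r * (2 / c) ^+ m / (e * T).
have c01 : 0 < c <= 1 by rewrite c0.
have hd (xi : R) : 0 < xi ->
    `|Re ((a +i* xi) ^+ r / \prod_(j < n) (1 - (a +i* xi) * (y j)%:C))| <= K1 / (1 + xi ^+ 2).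
  move=> xi0; apply: (le_trans (Re_le_normc _)).
  have kern := normc_spline_kernel_ge x1 x2 ax as01 c0 (lt0r_neq0 xi0) kc
    (fun j => lexx _) ks.
  rewrite a2 mulr1 -/e -/T in kern.
  have pk := @pow_le_kernel R r c xi c01; rewrite -/m in pk.
  have zz := normc_le_add a xi; rewrite a1 in zz.
  have qm : 0 < (1 + xi ^+ 2 * c) ^+ m.
    by rewrite exprn_gt0// ltr_pwDl// mulr_ge0 ?sqr_ge0// ltW.
  have x20 : 0 < 1 + xi ^+ 2 by rewrite ltr_pwDl// sqr_ge0.
  have eT : 0 < e * T by rewrite mulr_gt0.
  have N0 := lt_le_trans (mulr_gt0 eT qm) kern.
  rewrite normcM normcX normcV ler_pdivlMr//.
  move: (normc_ge0 (a +i* xi)) zz; set Z := normc (a +i* xi) => Z0 zz.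
  have Zr : Z ^+ r <= 2 ^+ r * (1 + `|xi|) ^+ r.
    rewrite -exprMn lerXn2r ?nnegrE ?mulr_ge0 ?addr_ge0//.
    by have := normr_ge0 xi; lra.
  rewrite mulrAC ler_pdivrMr//.
  apply: (@le_trans _ _ (K1 * (e * T * (1 + xi ^+ 2 * c) ^+ m))); last first.
    rewrite ler_wpM2l// divr_ge0 ?(ltW eT)//.
    by rewrite mulr_ge0 ?(ltW cm)// exprn_ge0.
  rewrite /K1 mulrA divfK ?gt_eqF//.
  apply: (@le_trans _ _ (2 ^+ r * ((1 + `|xi|) ^+ r * (1 + xi ^+ 2)))).
    by rewrite mulrA ler_wpM2r// ltW.
  by rewrite -mulrA ler_wpM2l// exprn_ge0.
have Sl : spline_primitive r y a T @[T --> +oo] --> pi * spline_sum r x t.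
  by rewrite spline_sum_shift; exact: cvg_spline_primitive.
have := limit_le_of_derive_le (spline_primitive0 r y a)
  (fun xi _ => @continuous_spline_primitive R n r y a xi)
  (fun xi xi0 => is_derive_spline_primitive yI rn ay (lt0r_neq0 xi0)) hd Sl.
have p0 : 0 < (pi : R) := pi_gt0 R.
rewrite normrM (gtr0_norm p0) mulrCA ler_pM2l// => h.
have eT : 0 < e * T by rewrite mulr_gt0.
have K10 : 0 <= K1.
  by rewrite divr_ge0 ?(ltW eT)// mulr_ge0 ?(ltW cm)// exprn_ge0.
have h1 : `|spline_sum r x t| <= K1 by lra.
apply: (le_trans (ler_wpM2l (exprn_ge0 p (normr_ge0 t)) h1)).
have -> : `|t| ^+ p * K1 = G * (`|t| ^+ p / T).
  by rewrite /K1 /G; field; rewrite !gt_eqF.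
have -> : G * 20 ^+ 3 / b ^+ P * L = G * (20 ^+ 3 / b ^+ P * L) by ring.
rewrite ler_pM2l// ler_pdivrMr//.
(* Inserting this factor raises the power of |t| from p to P, which T absorbs, and leaves
   [X ^+ 3 <= L]. *)
have q3 : 1 <= (20 * X * `|t|) ^+ 3.
  by rewrite exprn_ege1//; lra.
apply: (@le_trans _ _ (`|t| ^+ p * (20 * X * `|t|) ^+ 3)).
  by rewrite ler_peMr// exprn_ge0.
have -> : `|t| ^+ p * (20 * X * `|t|) ^+ 3 = 20 ^+ 3 * X ^+ 3 / b ^+ P * (b ^+ P * `|t| ^+ P).
  have -> : `|t| ^+ P = `|t| ^+ p * `|t| ^+ 3 by rewrite -exprD.
  by move: (b ^+ P) bP => u u0; field; rewrite gt_eqF.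
apply: ler_pM => //.
- by rewrite divr_ge0 ?(ltW bP)// mulr_ge0// exprn_ge0.
- by rewrite mulr_ge0 ?(ltW bP)// exprn_ge0.
- rewrite [leRHS]mulrAC ler_wpM2r ?invr_ge0 ?(ltW bP)//.
  by rewrite ler_wpM2l// exprn_ge0.
Qed.

End SplineTail.

(** * Derivatives of the spline sum *)

Section SplineDerivative.
Variable R : realType.
Local Open Scope classical_set_scope.

Lemma is_derive_pospow (m : nat) (u : R) :
  is_derive u 1 (fun v : R => Num.max v 0 ^+ m.+2) (m.+2%:R * Num.max u 0 ^+ m.+1).
Proof.
have [u0|u0|->] := ltgtP u 0.
- rewrite expr0n/= mulr0.
  apply: near_eq_is_derive (is_derive_cst1 0 u).
  near=> v; rewrite max_r ?expr0n//; near: v.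
  exact: lt_le_nbhsl.
- apply: near_eq_is_derive (is_derive_eq (is_derive_X1 m.+2 (is_derive_id1 u)) _).
    near=> v; rewrite max_l//; near: v.
    exact: lt_le_nbhsr.
  by rewrite mulr1.
(* At the kink the difference quotient is [Num.max h 0 ^+ m.+1]. *)
- rewrite expr0n/= mulr0.
  pose f (v : R) : R := Num.max v 0 ^+ m.+2.
  have H : (fun h : R => h^-1 *: (f (h *: (1 : R) + 0) - f 0)) @ (0 : R)^' --> (0 : R).
    apply: (@cvg_trans _ ((fun h : R => Num.max h 0 ^+ m.+1) @ (0 : R)^')).
      apply: near_eq_cvg; near=> h.
      have h0 : h != 0 by near: h; exact: nbhs_dnbhs_neq.
      rewrite /f maxxx [0 ^+ m.+2]expr0n/= subr0 addr0 /GRing.scale/= mulr1.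
      have [hp|hn] := leP h 0; first by rewrite !expr0n/= mulr0.
      by rewrite [in RHS]exprS mulKf.
    have cf : {for (0 : R), continuous (fun h : R => Num.max h 0 ^+ m.+1)}.
      apply: (@continuous_comp _ _ _ (fun v : R => Num.max v 0) (fun v => v ^+ m.+1)).
        by apply: continuous_max; [exact: cvg_id|exact: cvg_cst].
      exact: exprn_continuous.
    by move/continuous_withinNx: cf => /=; rewrite maxxx expr0n.
  apply: DeriveDef; first by apply/cvg_ex; exists 0; exact: H.
  by apply: cvg_lim => //; exact: H.
Unshelve. all: by end_near. Qed.

(** [r + 4 <= n] makes the exponent [n - 2 - r] at least 2, so that the truncated powers are
    differentiable also at their kinks. *)
Lemma is_derive_spline_sum (n r : nat) (x : 'I_n -> R) (t : R) : (r + 4 <= n)%N ->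
  is_derive t 1 (spline_sum r x)
    (- ((n - 2 - r)%:R / n%:R * spline_sum r.+1 x t)).
Proof.
move=> rn; have -> : (n - 2 - r)%N = (n - 4 - r).+2 by lia.
have e1 : (n - 2 - r)%N = (n - 4 - r).+2 by lia.
have e2 : (n - 2 - r.+1)%N = (n - 4 - r).+1 by lia.
rewrite /spline_sum e1 e2; move: (n - 4 - r)%N => m {e1 e2}.
rewrite mulr_sumr -sumrN; apply: is_derive_sum1 => k.
have hlin : is_derive t 1 (fun s : R => x k - s / n%:R) (- n%:R^-1).
  apply: is_derive_eq (is_derive_D1 (is_derive_cst1 (x k) t)
    (is_derive_N1 (is_derive_M1 (is_derive_id1 t) (is_derive_cst1 n%:R^-1 t)))) _.
  by rewrite mulr0 mulr1 !add0r.
have hpow := @is_derive_comp1 R (fun v => Num.max v 0 ^+ m.+2) (fun s => x k - s / n%:R)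
  t _ _ (is_derive_pospow m _) hlin.
have h := is_derive_M1 hpow
  (is_derive_cst1 (\prod_(j < n | j != k) (x k - x j))^-1 t).
by apply: is_derive_eq h _; rewrite mulr0 add0r; ring.
Qed.

(* The scalar by which [q] differentiations multiply the spline sum, up to sign. *)
Definition spline_rate (n r q : nat) : R := \prod_(i < q) ((n - 2 - r - i)%:R / n%:R).

(** The factors are 1 - d_i with d_i = (2 + r + i)/n in [0, 1], and 1 - prod (1 - d_i) <= sum
    d_i. *)
Lemma spline_rate_bounds (n r q : nat) : (0 < n)%N -> (r + q + 3 <= n)%N ->
  0 <= spline_rate n r q <= 1 /\
  1 - spline_rate n r q <= (\sum_(i < q) (2 + r + i))%:R / n%:R.
Proof.
move=> n0; have n0' : 0 < n%:R :> R by rewrite ltr0n.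
elim: q => [|q ih] rn.
  by rewrite /spline_rate !big_ord0 mul0r subrr ler01 lexx.
have [/andP[c0 c1] c2] := ih ltac:(lia).
rewrite /spline_rate big_ord_recr/= -/(spline_rate n r q) big_ord_recr/= natrD mulrDl.
have e : (n - 2 - r - q)%:R / n%:R = 1 - (2 + r + q)%:R / n%:R :> R.
  rewrite -!subnDA natrB; last by lia.
  by rewrite mulrBl divff ?gt_eqF// addnA.
have d0 : 0 <= (2 + r + q)%:R / n%:R :> R by rewrite divr_ge0// ltW.
have d1 : (2 + r + q)%:R / n%:R <= 1 :> R.
  by rewrite ler_pdivrMr// mul1r ler_nat; lia.
move: c0 c1 c2 d0 d1; rewrite e; move: (spline_rate n r q) (_ / n%:R) (_ / n%:R) => c d f.
move=> c0 c1 c2 d0 d1; split; last by nra.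
by apply/andP; split; nra.
Qed.

Lemma derive1n_gauss_sub_spline (n r q : nat) (x : 'I_n -> R) (t : R) :
  (r + q + 3 <= n)%N ->
  derive1n q (fun s => hermite_gauss r s - spline_sum r x s) t =
  (-1) ^+ q * (hermite_gauss (r + q) t - spline_rate n r q * spline_sum (r + q) x t).
Proof.
elim: q t => [|q ih] t rn.
  by rewrite addn0 /spline_rate big_ord0 expr0 !mul1r.
rewrite derive1nS.
rewrite (_ : derive1n q _ = fun s => (-1) ^+ q *
   (hermite_gauss (r + q) s - spline_rate n r q * spline_sum (r + q) x s)); last first.
  by apply/funext => s; rewrite ih//; lia.
have h := is_derive_M1 (is_derive_cst1 ((-1) ^+ q) t)
  (is_derive_D1 (is_derive_hermite_gauss (r + q) t)
    (is_derive_N1 (is_derive_M1 (is_derive_cst1 (spline_rate n r q) t)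
       (@is_derive_spline_sum n (r + q) x t ltac:(lia))))).
rewrite derive1E (@derive_val _ _ _ _ _ _ _ h).
rewrite /spline_rate big_ord_recr/= -/(spline_rate n r q) addnS [(-1) ^+ q.+1]exprS.
by rewrite -(subnDA r (n - 2) q); ring.
Qed.

Lemma exists_max_norm (n : nat) (x : 'I_n -> R) (L : R) : (0 < n)%N ->
  \sum_(k < n) `|x k| ^+ 3 = L ->
  exists2 X : R, (forall j, `|x j| <= X) & X ^+ 3 <= L.
Proof.
move=> n0 x3.
have [|i _ hi] := @Order.TotalTheory.arg_maxP _ _ _ (Ordinal n0) xpredT (fun j => `|x j|); first by [].
exists `|x i|; first by move=> j; exact: hi.
rewrite -x3 (bigD1 i)//= lerDl; apply: sumr_ge0 => j _.
by rewrite exprn_ge0.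
Qed.

Lemma spline_sum_approx (p r : nat) : exists n0 : nat, exists2 K : R, 0 < K &
  exists2 eps : R, 0 < eps <= 1 &
  forall (n : nat) (x : 'I_n -> R) (L t : R), (n0 <= n)%N -> injective x ->
    \sum_(j < n) x j = 0 -> \sum_(j < n) x j ^+ 2 = 1 ->
    \sum_(j < n) `|x j| ^+ 3 = L -> L <= eps ->
    `|t| ^+ p * `|hermite_gauss r t - spline_sum r x t| <= K * L.
Proof.
have [K1 K10 [eta1 eta10 h1]] := spline_sum_central R p r.
have [K2 K20 [eta2 eta20 h2]] := spline_sum_tail R p r.
have [K3 K30 h3] := @hermite_gauss_bound R r (p + 3).
pose eta := Num.min 1 (Num.min eta1 eta2).
have eta0 : 0 < eta by rewrite !lt_min ltr01 eta10.
have eta_1 : eta <= 1 by rewrite ge_min lexx.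
exists (r + 3 + (p + 3))%N, (K1 + K2 + 20 ^+ 3 * K3).
  by rewrite !addr_gt0// mulr_gt0// exprn_gt0.
(* [X ^+ 3 <= L <= eta ^+ 3] forces [X <= eta], the smallness needed in both ranges. *)
exists (eta ^+ 3); first by rewrite exprn_gt0//= exprn_ile1// ltW.
move=> n x L t nn xI x1 x2 x3 Leps.
have rn : (r + 3 <= n)%N := leq_trans (leq_addr _ _) nn.
have pn : (p + 3 <= n)%N := leq_trans (leq_addl _ _) nn.
have npos : (0 < n)%N by rewrite (leq_trans _ rn)// addn3.
have [L0 _ _] := sum_sqr_cube x2 x3.
have [X xX XL] := exists_max_norm npos x3.
have X0 : 0 <= X by exact: le_trans (normr_ge0 _) (xX (Ordinal npos)).
have Xeta : X <= eta.
  by rewrite -(@ler_pXn2r _ 3)// ?nnegrE ?(ltW eta0)// (le_trans XL).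
have L1 : L <= 1 by apply: (le_trans Leps); rewrite exprn_ile1// ltW.
have q1 : 0 <= K1 * L by rewrite mulr_ge0 ?ltW.
have q2 : 0 <= K2 * L by rewrite mulr_ge0 ?ltW.
have q3 : 0 <= 20 ^+ 3 * K3 * L.
  by apply: mulr_ge0; rewrite ?(ltW L0)// mulr_ge0 ?(ltW K30)// exprn_ge0.
have [tX|tX] := leP (`|t| * X) (1/20).
  have := h1 n x L X t rn xI x1 x2 x3 L1 xX _ tX.
  have -> : X <= eta1 by rewrite (le_trans Xeta)// !ge_min lexx orbT.
  by move=> /(_ isT); lra.
have := h2 n x L X t rn pn xI x1 x2 xX XL _ tX.
have -> : X <= eta2 by rewrite (le_trans Xeta)// !ge_min lexx !orbT.
move=> /(_ isT) hS.
have hG : `|t| ^+ p * `|hermite_gauss r t| <= 20 ^+ 3 * K3 * L.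
  have q : 1 <= (20 * X * `|t|) ^+ 3 by rewrite exprn_ege1//; lra.
  have g0 : 0 <= `|t| ^+ p * `|hermite_gauss r t| by rewrite mulr_ge0// exprn_ge0.
  apply: (@le_trans _ _ (`|t| ^+ p * `|hermite_gauss r t| * (20 * X * `|t|) ^+ 3)).
    by rewrite ler_peMr.
  have -> : `|t| ^+ p * `|hermite_gauss r t| * (20 * X * `|t|) ^+ 3 =
     (20 ^+ 3 * X ^+ 3) * (`|t| ^+ (p + 3) * `|hermite_gauss r t|).
    by rewrite !exprMn [`|t| ^+ (p + 3)]exprD; move: (20 ^+ 3) => u; ring.
  have -> : 20 ^+ 3 * K3 * L = 20 ^+ 3 * L * K3 by rewrite mulrAC.
  have a0 : 0 <= 20 ^+ 3 :> R by exact: exprn_ge0.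
  have b0 : 0 <= `|t| ^+ (p + 3) * `|hermite_gauss r t|.
    by apply: mulr_ge0 => //; exact: exprn_ge0.
  exact: ler_pM (mulr_ge0 a0 (exprn_ge0 3 X0)) b0 (ler_wpM2l a0 XL) (h3 t).
apply: (@le_trans _ _ (`|t| ^+ p * (`|hermite_gauss r t| + `|spline_sum r x t|))).
  by rewrite ler_wpM2l ?exprn_ge0// ler_normB.
by rewrite mulrDr; lra.
Qed.

End SplineDerivative.

Theorem corollary2 (R : realType) (p q r : nat) :
  exists (n0 : nat) (eps C : R), 0 < eps /\ 0 < C /\
    forall (n : nat) (x : 'I_n -> R),
      (n0 <= n)%N ->
      (forall i j : 'I_n, (i < j)%N -> x i < x j) ->
      \sum_(k < n) x k = 0 ->
      \sum_(k < n) x k ^+ 2 = 1 ->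
      \sum_(k < n) `|x k| ^+ 3 <= eps ->
      forall t : R,
        `| t ^+ p *
           derive1n q (fun s : R =>
              (Num.sqrt (2 * pi))^-1 * hermite r s * expR (- s ^+ 2 / 2)
              - \sum_(k < n)
                  Num.max (x k - s / n%:R) 0 ^+ (n - 2 - r)%N
                  / \prod_(j < n | j != k) (x k - x j)) t |
        <= C * \sum_(k < n) `|x k| ^+ 3.
Proof.
have [n0 [K K0 [eps /andP[eps0 eps1] hK]]] := spline_sum_approx R p (r + q).
have [K3 K30 h3] := @hermite_gauss_bound R (r + q) p.
pose W : nat := \sum_(i < q) (2 + r + i).
exists (n0 + (r + q + 3))%N, eps, (K + K3 * (W%:R * 8)); split=> //; split.
  by rewrite ltr_pwDl// !mulr_ge0// ltW.
move=> n x nn xlt x1 x2.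
have nn0 : (n0 <= n)%N := leq_trans (leq_addr _ _) nn.
have rqn : (r + q + 3 <= n)%N := leq_trans (leq_addl _ _) nn.
have npos' : (0 < n)%N by rewrite (leq_trans _ rqn)// addn3.
move x3 : (\sum_(k < n) `|x k| ^+ 3) => L Leps t.
have xI : injective x.
  move=> i j xij; apply/val_inj; case: (ltngtP i j) => // /xlt; by rewrite xij ltxx.
have [L0 nL _] := sum_sqr_cube x2 x3.
have npos : 0 < n%:R :> R by rewrite ltr0n.
rewrite (_ : (fun s : R => _) = fun s => hermite_gauss r s - spline_sum r x s); last first.
  by apply/funext => s; rewrite hermite_gaussE.
rewrite derive1n_gauss_sub_spline//.
have [/andP[c0 c1] c2] := spline_rate_bounds R npos' rqn.
rewrite mulrCA normrM normrX normrN1 expr1n mul1r normrM normrX.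
move: c0 c1 c2; set c := spline_rate R n r q => c0 c1 c2.
set H := hermite_gauss _ _; set S := spline_sum _ _ _.
have main := hK n x L t nn0 xI x1 x2 x3 Leps.
have t0 : 0 <= `|t| ^+ p by rewrite exprn_ge0.
have c0' : 0 <= 1 - c by rewrite subr_ge0.
(* The defect 1 - c is O(1/n), hence O(L). It is charged to H, for which [hermite_gauss_bound] gives
   a bound free of n and L, and not to S. *)
have -> : H - c * S = c * (H - S) + (1 - c) * H by ring.
apply: (@le_trans _ _ (`|t| ^+ p * (`|H - S| + (1 - c) * `|H|))).
  rewrite ler_wpM2l// (le_trans (ler_normD _ _))// !normrM.
  by rewrite (ger0_norm c0) (ger0_norm c0') lerD2r ler_piMl.
have c3 : 1 - c <= W%:R * 8 * L.
  apply: (le_trans c2); rewrite -/W -mulrA ler_wpM2l//.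
  rewrite -[n%:R^-1]mul1r ler_pdivrMr// (le_trans nL)//.
  have LL : L ^+ 2 <= L by rewrite expr2 ler_piMl ?(ltW L0)// (le_trans Leps).
  by have := ler_wpM2l (ltW npos) LL; lra.
rewrite mulrDr [leRHS]mulrDl; apply: lerD; first exact: main.
rewrite mulrCA; apply: (@le_trans _ _ ((1 - c) * K3)).
  by rewrite ler_wpM2l ?subr_ge0//; exact: h3.
by rewrite mulrC -mulrA ler_wpM2l// ltW.
Qed.
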